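(* Let $a_{i_1}\cdots a_{i_k}$ and $a_{i_1}\cdots a_{i_k}a_j$ both be reduced words (so they represent permutations $\sigma_1$ and $\sigma_0=\sigma_1a_j$ in $S_{n+1}$ with $\operatorname{inv}(\sigma_1)=k$ and $\operatorname{inv}(\sigma_0)=k+1$). Let $\varepsilon_1,\ldots,\varepsilon_k,\varepsilon\in\{\pm1\}$ and set $z_1=(\acute a_{i_1})^{\varepsilon_1}\cdots(\acute a_{i_k})^{\varepsilon_k}$ and $z_0=z_1(\acute a_j)^{\varepsilon}$, elements of $\widetilde{\mathrm B}^+_{n+1}$. Given $q\in\operatorname{Quat}_{n+1}$, the map $$\Phi:\operatorname{Bru}_{qz_1}\times(0,\pi)\to\operatorname{Bru}_{qz_0},\qquad \Phi(z,\theta)=z\,\alpha_j(\varepsilon\theta),$$ is a diffeomorphism.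
   Context: Fix an integer $n\ge2$. $S_{n+1}$ is the group of permutations of $\{1,\ldots,n+1\}$ acting on the right, $(\sigma,k)\mapsto k^\sigma$, so $k^{\sigma_1\sigma_2}=(k^{\sigma_1})^{\sigma_2}$; it is generated by $a_j=(j,j+1)$, $1\le j\le n$. $\operatorname{inv}(\sigma)$ is the number of pairs $i<j$ with $i^\sigma>j^\sigma$; a reduced word for $\sigma$ is an expression $\sigma=a_{i_1}\cdots a_{i_k}$ with $k=\operatorname{inv}(\sigma)$. $\Pi:\operatorname{Spin}_{n+1}\to\operatorname{SO}_{n+1}$ is the universal (double) covering homomorphism. Let $\mathfrak a_j\in\mathfrak{so}_{n+1}$ have nonzero entries only $(\mathfrak a_j)_{j+1,j}=1$, $(\mathfrak a_j)_{j,j+1}=-1$. Identifying the Lie algebra of $\operatorname{Spin}_{n+1}$ with $\mathfrak{so}_{n+1}$ via $\Pi$, let $\alpha_j(\theta)=\exp(\theta\mathfrak a_j)\in\operatorname{Spin}_{n+1}$ and $\acute a_j=\alpha_j(\pi/2)$. $\mathrm B^+_{n+1}\subset\operatorname{SO}_{n+1}$ is the group of signed permutation matrices of determinant $1$; for such $P$, $\sigma_P\in S_{n+1}$ is defined by $e_j^\top P=\pm e_{j^{\sigma_P}}^\top$ for all $j$. $\operatorname{Diag}^+_{n+1}\subset \mathrm B^+_{n+1}$ is the subgroup of diagonal matrices. $\widetilde{\mathrm B}^+_{n+1}=\Pi^{-1}[\mathrm B^+_{n+1}]$, $\operatorname{Quat}_{n+1}=\Pi^{-1}[\operatorname{Diag}^+_{n+1}]$.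 $\operatorname{Up}^+_{n+1}$ is the group of real upper triangular $(n+1)\times(n+1)$ matrices with strictly positive diagonal entries. For $z\in\widetilde{\mathrm B}^+_{n+1}$ with $P=\Pi(z)$, the signed Bruhat cell $\operatorname{Bru}_z\subset\operatorname{Spin}_{n+1}$ is the connected component containing $z$ of $\Pi^{-1}\big[(\operatorname{Up}^+_{n+1}P\operatorname{Up}^+_{n+1})\cap\operatorname{SO}_{n+1}\big]$; it is a contractible smooth submanifold of dimension $\operatorname{inv}(\sigma_P)$. *)

(* Defs.v *)
From HB Require Import structures.
From mathcomp Require Import all_boot all_order all_algebra all_fingroup.
From mathcomp Require Import all_classical all_reals all_analysis.

Set Implicit Arguments.
Unset Strict Implicit.
Unset Printing Implicit Defensive.

Import Order.TTheory GRing.Theory Num.Theory.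
Import numFieldNormedType.Exports.

Local Open Scope classical_set_scope.
Local Open Scope ring_scope.

(* The indices 1, ..., n+1 are 'I_n.+1 and the indices 1, ..., n of the
   generators are 'I_n, both starting from 0.  For j : 'I_n the elements
   idx j and idxS j of 'I_n.+1 stand for j and j + 1. *)
Definition idx (n : nat) (j : 'I_n) : 'I_n.+1 := widen_ord (leqnSn n) j.
Definition idxS (n : nat) (j : 'I_n) : 'I_n.+1 := lift ord0 j.

(* Products in 'S_n.+1 are read from left to right: (s * t)%g x = t (s x). *)
Definition coxeter (n : nat) (j : 'I_n) : 'S_n.+1 := tperm (idx j) (idxS j).

Definition inversions (n : nat) (s : 'S_n.+1) : nat :=
  #|[set p : 'I_n.+1 * 'I_n.+1 | (p.1 < p.2)%N && (s p.2 < s p.1)%N]%SET|.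

Definition word_perm (n k : nat) (i : 'I_k -> 'I_n) : 'S_n.+1 :=
  (\prod_(l < k) coxeter (i l))%g.

Section SmoothMaps.
Variables (R : realType) (V W : normedModType R).

(* V and W are meant to be finite-dimensional, where asking that x |-> 'd f x v
   be C^k for each v amounts to asking that the differential be C^k. *)
Fixpoint class_C (k : nat) (U : set V) (f : V -> W) : Prop :=
  match k with
  | 0 => forall x, U x -> {for x, continuous f}
  | k'.+1 => (forall x, U x -> differentiable f x) /\
             (forall v : V, class_C k' U (fun x => 'd f x v))
  end.

Definition smooth_on (X : set V) (f : V -> W) : Prop :=
  forall x, X x -> exists (U : set V) (F : V -> W),
    [/\ open U, U x, (forall k, class_C k U F) & {in X `&` U, f =1 F}].

End SmoothMaps.

(* For embedded submanifolds X and Y of finite-dimensional normed spaces this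
   is the usual notion: a map on X is smooth if and only if it extends locally
   to a smooth map on the ambient space. *)
Definition diffeomorphism (R : realType) (V W : normedModType R)
    (X : set V) (Y : set W) (f : V -> W) : Prop :=
  exists g : W -> V,
    [/\ set_fun X Y f, set_fun Y X g,
        {in X, cancel f g}, {in Y, cancel g f}
      & smooth_on X f /\ smooth_on Y g].

Section MatrixFunctions.
Variables (R : realType) (N : nat).

Definition mexp (X : 'M[R]_N) : 'M[R]_N :=
  lim (series (fun k : nat => (k`!%:R)^-1 *: X ^+ k) @ \oo).

(* exprz is only available on 'M[R]_N for syntactically positive N. *)
Definition zpowmx (g : 'M[R]_N) (e : int) : 'M[R]_N :=
  match e with
  | Posz m => g ^+ m
  | Negz m => invmx g ^+ m.+1
  end.

End MatrixFunctions.

Section Spin.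
Variables (R : realType) (n : nat).

Local Notation set_idx := {set 'I_n.+1}.

(* The Clifford algebra of R^(n+1), with relations
   e_k e_l + e_l e_k = -2 delta_kl, has a basis (e_A) indexed by the subsets A
   of the set of indices: e_A is the product of the e_a, a in A, in increasing
   order.  It is represented faithfully by its left multiplications, written
   as matrices in that basis. *)
Local Notation Cl := 'M[R]_#|{set 'I_n.+1}|.

Definition flip (k : 'I_n.+1) (A : set_idx) : set_idx :=
  [set x | (x \in A) (+) (x == k)]%SET.

(* e_k e_A is plus or minus e_(flip k A): there is one sign for each a < k in A
   that e_k has to be moved past, and one for e_k e_k = -1 if k is in A. *)
Definition gen (k : 'I_n.+1) : Cl :=
  \matrix_(b, a) (if enum_val b == flip k (enum_val a) then
    (-1) ^+ #|[set x in enum_val a | (x <= k)%N]%SET| else 0).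

Definition clv (v : 'cV[R]_n.+1) : Cl := \sum_k v k 0 *: gen k.

Definition Spin : set Cl :=
  [set z | exists s : seq 'cV[R]_n.+1,
    [/\ ~~ odd (size s), (forall v, v \in s -> \sum_k v k 0 ^+ 2 = 1)
      & z = \prod_(v <- s) clv v]].

(* Since e_A = 1 for A empty, the entry of the left multiplication by x in the
   row of e_k and the column of e_A is the coordinate of x along e_k, so that
   Pi is determined by z * clv v * z^-1 = clv (Pi z *m v); see Spin_conj. *)
Definition Pi (z : Cl) : 'M[R]_n.+1 :=
  \matrix_(k, l) (z *m gen l *m invmx z)
    (enum_rank [set k]%SET) (enum_rank finset.set0).

(* The inverse of the differential of Pi at 1: the Lie algebra of Spin acts on
   vectors by commutators; see so_lift_comm. *)
Definition so_lift (A : 'M[R]_n.+1) : Cl :=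
  4^-1 *: \sum_k \sum_l A l k *: (gen k *m gen l).

Definition so_gen (j : 'I_n) : 'M[R]_n.+1 :=
  delta_mx (idxS j) (idx j) - delta_mx (idx j) (idxS j).

Definition alpha (j : 'I_n) (t : R) : Cl := mexp (t *: so_lift (so_gen j)).

Definition acute (j : 'I_n) : Cl := alpha j (pi / 2).

Definition word_spin (k : nat) (i : 'I_k -> 'I_n) (e : 'I_k -> int) : Cl :=
  \prod_(l < k) zpowmx (acute (i l)) (e l).

Definition SO : set 'M[R]_n.+1 :=
  [set Q | Q^T *m Q = 1%:M /\ \det Q = 1].

Definition Bplus : set 'M[R]_n.+1 :=
  [set P | \det P = 1 /\ exists (s : 'S_n.+1) (d : 'I_n.+1 -> bool),
    P = \matrix_(k, l) (if l == s k then (-1) ^+ d k else 0)].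

Definition Diagplus : set 'M[R]_n.+1 := Bplus `&` [set P | is_diag_mx P].

Definition Quat : set Cl := Spin `&` Pi @^-1` Diagplus.

Definition Upplus : set 'M[R]_n.+1 :=
  [set U | (forall k l : 'I_n.+1, (l < k)%N -> U k l = 0) /\
           (forall k, 0 < U k k)].

Definition bruhat_cell (P : 'M[R]_n.+1) : set 'M[R]_n.+1 :=
  [set Q | exists U1 U2, [/\ Upplus U1, Upplus U2 & Q = U1 *m P *m U2]].

Definition Bru (z : Cl) : set Cl :=
  connected_component (Spin `&` Pi @^-1` (bruhat_cell (Pi z) `&` SO)) z.

Lemma odd_flip (k l : 'I_n.+1) (A : set_idx) :
  odd #|[set x in flip l A | (x <= k)%N]%SET| =
  odd #|[set x in A | (x <= k)%N]%SET| (+) (l <= k)%N.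
Proof.
have E (B : set_idx) : #|[set x in B | (x <= k)%N]%SET| =
    ((\sum_(x : 'I_n.+1 | x != l) ((x \in B) && (x <= k))) + ((l \in B) && (l <= k)))%N.
  rewrite -sum1dep_card big_mkcond (bigD1 l) //= addnC; congr addn.
rewrite !E !oddD !oddb inE eqxx addbT.
rewrite (eq_bigr (fun x => ((x \in A) && (x <= k)%N) : nat)); last first.
  by move=> x /negbTE xl; rewrite inE xl addbF.
by case: (l \in A); case: (l <= k)%N; rewrite /= ?addbF ?addbT ?negbK.
Qed.

Lemma gen_mul (k l : 'I_n.+1) b a :
  (gen k *m gen l) b a =
  if enum_val b == flip k (flip l (enum_val a)) then
   (-1) ^+ (#|[set x in enum_val a | (x <= k)%N]%SET| +
            #|[set x in enum_val a | (x <= l)%N]%SET| + (l <= k))%N else 0.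
Proof.
rewrite mxE (bigD1 (enum_rank (flip l (enum_val a)))) //= big1 ?addr0.
  rewrite !mxE !enum_rankK eqxx; case: ifP => _; last by rewrite mul0r.
  by rewrite -exprD -[LHS]signr_odd -[RHS]signr_odd !oddD odd_flip !oddb addbAC.
move=> c cl; rewrite !mxE; case: ifPn => [_|_]; last by rewrite mul0r.
case: eqP => [cE|_]; last by rewrite mulr0.
by rewrite -cE enum_valK eqxx in cl.
Qed.

Lemma flipC k l A : flip k (flip l A) = flip l (flip k A).
Proof. by apply/setP => x; rewrite !inE addbAC. Qed.

Lemma flipK k A : flip k (flip k A) = A.
Proof. by apply/setP => x; rewrite !inE addbK. Qed.

Lemma gen_comm (k l : 'I_n.+1) :
  gen k *m gen l + gen l *m gen k = (- ((k == l)%:R *+ 2))%:M.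
Proof.
apply/matrixP => b a; rewrite mxE !gen_mul (flipC l k).
rewrite (addnC #|[set x in enum_val a | (x <= l)%N]%SET|).
rewrite ![(-1) ^+ (_ + (_ <= _)%N)]exprD.
set s := (-1) ^+ _; rewrite mxE.
case: (eqVneq k l) => [kl|kl].
  subst l; rewrite leqnn flipK expr1 (inj_eq enum_val_inj).
  case: (b == a); rewrite ?addr0 ?mulr0n // mulr1n mulrN1.
  by rewrite /s addnn -mul2n exprM sqrrN expr1n expr1n mulr2n opprD.
rewrite mul0rn oppr0 mul0rn; case: ifP => _; last by rewrite addr0.
rewrite -mulrDr.
have : (val k != val l) by [].
by case: ltngtP => // _ _; rewrite ?expr0 ?expr1 ?subrr ?addNr mulr0.
Qed.

Lemma gen_sqr (k : 'I_n.+1) : gen k *m gen k = (-1)%:M.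
Proof.
have h : (2 : R) != 0 by rewrite pnatr_eq0.
apply: (scalerI h); rewrite scaler_nat mulr2n gen_comm eqxx.
by rewrite scale_scalar_mx mulrN1.
Qed.

Lemma clv_is_linear : linear clv.
Proof.
move=> c u v; rewrite /clv scaler_sumr -big_split; apply: eq_bigr => k _ /=.
by rewrite !mxE scalerDl scalerA.
Qed.

HB.instance Definition _ :=
  GRing.isLinear.Build R 'cV[R]_n.+1 Cl _ clv clv_is_linear.

Lemma clv_delta k : clv (delta_mx k 0) = gen k.
Proof.
rewrite /clv (bigD1 k) //= big1 ?addr0; first by rewrite mxE !eqxx scale1r.
by move=> l /negbTE lk; rewrite mxE lk scale0r.
Qed.

Lemma clv_coord v k : clv v (enum_rank [set k]%SET) (enum_rank finset.set0) = v k 0.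
Proof.
have f0 l : flip l finset.set0 = [set l]%SET by apply/setP => x; rewrite !inE.
have c0 (l : 'I_n.+1) : #|[set x in (@finset.set0 'I_n.+1) | (x <= l)%N]%SET| = 0%N.
  by apply/eqP; rewrite cards_eq0; apply/eqP/setP => x; rewrite !inE.
rewrite /clv summxE (bigD1 k) //= big1 ?addr0.
  by rewrite !mxE !enum_rankK f0 eqxx c0 mulr1.
move=> l lk; rewrite !mxE !enum_rankK f0.
case: eqP => [/set1_inj kl|_]; last by rewrite mulr0.
by rewrite kl eqxx in lk.
Qed.

Lemma clv_comm u v : clv u *m clv v + clv v *m clv u =
  (- ((\sum_k u k 0 * v k 0) *+ 2))%:M.
Proof.
have E u' v' : clv u' *m clv v' =
    \sum_k \sum_l (u' k 0 * v' l 0) *: (gen k *m gen l).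
  rewrite /clv mulmx_suml; apply: eq_bigr => k _.
  rewrite mulmx_sumr; apply: eq_bigr => l _.
  by rewrite -scalemxAl -scalemxAr scalerA.
rewrite !E [X in _ + X]exchange_big -big_split /=.
transitivity (\sum_k \sum_l (u k 0 * v l 0) *: ((- ((k == l)%:R *+ 2))%:M : Cl)).
  apply: eq_bigr => k _; rewrite -big_split; apply: eq_bigr => l _ /=.
  by rewrite [v l 0 * _]mulrC -scalerDr gen_comm.
rewrite -scalemx1 -sumrMnl -sumrN scaler_suml; apply: eq_bigr => k _.
rewrite (bigD1 k) //= big1 ?addr0.
  by rewrite eqxx !scale_scalar_mx mulr1 mulrN mulr_natr.
by move=> l /negbTE lk; rewrite eq_sym lk mul0rn oppr0 scale_scalar_mx mulr0 -scalemx1 scale0r.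
Qed.

Lemma clv_sqr (v : 'cV[R]_n.+1) : \sum_k v k 0 ^+ 2 = 1 -> clv v *m clv v = - 1%:M.
Proof.
move=> v1; have h : (2 : R) != 0 by rewrite pnatr_eq0.
apply: (scalerI h); rewrite scaler_nat mulr2n clv_comm.
rewrite (eq_bigr (fun k => v k 0 ^+ 2)) // v1.
by rewrite scalerN scale_scalar_mx mulr1 raddfN.
Qed.

Lemma gen_comm_clv (l : 'I_n.+1) v :
  gen l *m clv v = - (clv v *m gen l) - (v l 0 *+ 2) *: 1%:M.
Proof.
have := clv_comm (delta_mx l 0) v; rewrite clv_delta (bigD1 l) //= big1.
  rewrite addr0 mxE !eqxx mul1r scalemx1 raddfN => <-.
  by rewrite addrCA addNr addr0.
by move=> k /negbTE kl; rewrite mxE kl mul0r.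
Qed.

Lemma so_lift_comm (A : 'M[R]_n.+1) v : A^T = - A ->
  so_lift A *m clv v - clv v *m so_lift A = clv (A *m v).
Proof.
move=> AT; have Aas k l : A l k = - A k l by move/matrixP/(_ k l): AT; rewrite !mxE.
have B k l : gen k *m gen l *m clv v - clv v *m (gen k *m gen l) =
    (v k 0 *+ 2) *: gen l - (v l 0 *+ 2) *: gen k.
  rewrite -mulmxA gen_comm_clv mulmxBr mulmxN.
  rewrite [gen k *m (clv v *m _)]mulmxA [gen k *m clv v]gen_comm_clv.
  rewrite mulmxBl mulNmx -scalemxAl mul1mx -scalemxAr mulmx1 -mulmxA.
  by rewrite opprB opprK -[LHS]addrA -opprD [X in _ - X]addrC opprD addrA addrK.
have -> : so_lift A *m clv v - clv v *m so_lift A =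
    4^-1 *: \sum_k \sum_l A l k *: ((v k 0 *+ 2) *: gen l - (v l 0 *+ 2) *: gen k).
  rewrite /so_lift -scalemxAl -scalemxAr -scalerBr; congr (_ *: _).
  rewrite mulmx_suml mulmx_sumr -sumrB; apply: eq_bigr => k _.
  rewrite mulmx_suml mulmx_sumr -sumrB; apply: eq_bigr => l _.
  by rewrite -scalemxAl -scalemxAr -scalerBr B.
have clvA : clv (A *m v) = \sum_k \sum_l (A l k * v k 0) *: gen l.
  rewrite exchange_big /=; apply: eq_bigr => l _.
  by rewrite mxE scaler_suml.
have clvN : - clv (A *m v) = \sum_k \sum_l (A l k * v l 0) *: gen k.
  rewrite clvA exchange_big -sumrN /=; apply: eq_bigr => k _.
  rewrite -sumrN; apply: eq_bigr => l _.
  by rewrite [A k l]Aas mulNr scaleNr opprK.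
have -> : \sum_k \sum_l A l k *: ((v k 0 *+ 2) *: gen l - (v l 0 *+ 2) *: gen k)
    = 2 *: (clv (A *m v) - - clv (A *m v)).
  rewrite clvN {1}clvA -sumrB scaler_sumr; apply: eq_bigr => k _.
  rewrite -sumrB scaler_sumr; apply: eq_bigr => l _.
  have E (x y : R) : x * (y *+ 2) = 2 * (x * y) by rewrite mulrnAr mulr_natl.
  by rewrite scalerBr [RHS]scalerBr [in LHS]scalerA [in LHS]scalerA [in RHS]scalerA [in RHS]scalerA !E.
rewrite opprK -[_ + _]mulr2n -[clv _ *+ 2]scaler_nat !scalerA.
by rewrite -natrM mulVf ?scale1r // pnatr_eq0.
Qed.

Lemma Spin_conj z v : Spin z ->
  z \in unitmx /\ z *m clv v *m invmx z = clv (Pi z *m v).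
Proof.
move=> [s [_ s1 zE]].
suff [zU [Q zQ]] : z \in unitmx /\
    exists Q : 'M[R]_n.+1, forall w, z *m clv w = clv (Q *m w) *m z.
  have -> : Pi z = Q.
    apply/matrixP => k l; rewrite mxE -clv_delta zQ mulmxK // clv_coord.
    by rewrite -colE mxE.
  by rewrite zQ mulmxK.
elim: s s1 z zE => [|u s IHs] s1 z ->.
  rewrite big_nil unitmx1; split=> //; exists 1%:M => w.
  by rewrite !mul1mx mulmx1.
have [|zU [Q zQ]] := IHs _ _ erefl.
  by move=> w ws; apply: s1; rewrite in_cons ws orbT.
have u2 := clv_sqr (s1 u (mem_head _ _)).
rewrite big_cons; set y := \prod_(w <- s) clv w in zU zQ *.
split.
  rewrite unitmx_mul zU andbT.
  have /mulmx1_unit[] // : clv u *m (- clv u) = 1%:M.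
  by rewrite mulmxN u2 opprK.
exists ((2 *: (u *m u^T) - 1%:M) *m Q) => w.
rewrite -[clv u * y]/(clv u *m y) -[LHS]mulmxA zQ !mulmxA; congr (_ *m y).
set x := Q *m w; rewrite -mulmxA -/x.
have -> : (2 *: (u *m u^T) - 1%:M) *m x = ((\sum_k u k 0 * x k 0) *+ 2) *: u - x.
  rewrite mulmxBl mul1mx -scalemxAl -mulmxA; congr (_ - _).
  have -> : u^T *m x = (\sum_k u k 0 * x k 0)%:M.
    apply/matrixP => a b; rewrite !ord1 mxE [RHS]mxE eqxx.
    by apply: eq_bigr => k _; rewrite mxE.
  by rewrite mul_mx_scalar scalerA mulr_natl.
rewrite linearB linearZ /= mulmxBl -scalemxAl u2 scalerN scalemx1.
by rewrite -raddfN /= -clv_comm addrK.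
Qed.

End Spin.

(* Main.v *)
Require Import Defs.
From mathcomp Require Import all_boot all_order all_algebra all_fingroup.
From mathcomp Require Import all_classical all_reals all_analysis.
From HB Require Import structures.
From mathcomp Require Import ring lra zify.

Import Order.TTheory GRing.Theory Num.Theory.
Import numFieldNormedType.Exports.

Local Open Scope classical_set_scope.
Local Open Scope ring_scope.

Set Implicit Arguments.
Unset Strict Implicit.
Unset Printing Implicit Defensive.

(** Write [a = j], [b = j + 1] for the two indices that the rotations [alpha j]
    mix, [P1] and [P0] for the images in SO of [q z1] and [q z0], so that
    [P0 = P1 R(eps pi/2)] with [R(t) = Pi (alpha j t)], and [s1], [s0] for the
    permutations below them.  That both words are reduced says that [s1^-1 a]
    comes before [s1^-1 b].

    The map goes from cell to cell.  If [Q = U1 P1 U2] and [0 < t < pi], then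
    the Bruhat decomposition of SL_2 gives
    [U2 R(eps t) = (1 + x E_ab) R(eps pi/2) U'] with [U'] upper triangular with
    positive diagonal, and [P1 (1 + x E_ab) = (1 + y E) P1] with [E] the
    elementary matrix at [(s1^-1 a, s1^-1 b)], which is upper triangular.  Hence
    [Q R(eps t)] lies in the cell of [P0].  Moreover
    [U'_ab / U'_aa = eps cot t] (lemma [bruhat_cell_rot]).

    The map is undone as follows.  If [Q = U1 P0 U2], then the ratio
    [U2_ab / U2_aa] depends on [Q] only, and it is the rational function
    [cell_ratio] of [Q], whose denominator does not vanish on the cell
    ([flag_mx_unit], [cell_ratioE]).  So the only possible angle is
    [theta = pi/2 - atan (eps cell_ratio)], a smooth function with values between
    [0] and [pi], and rotating [Q] back by this angle does lead to the cell of
    [P1] ([bruhat_cell_rotV]).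

    In the spin group, [alpha j t = cos (t/2) + sin (t/2) e_a e_b], and [Pi] is
    multiplicative and agrees on [Spin] with a polynomial map, because the
    elements of [Spin] are orthogonal matrices.  Thus both maps extend to smooth
    maps on open sets: their coordinates are made from polynomials, inverses,
    [sin], [cos] and [atan].  Finally, a connected component goes to a connected
    component because both maps are continuous, and they exchange the base
    points, [(q z1, pi/2)] and [q z0]. *)

(** * Smooth maps *)

Section ClassC.
Variables (R : realType) (V : normedModType R).

(** Differentiability is local: [g - f] vanishes near [x], so that [g] has the
    first order expansion of [f]. *)
Lemma is_diff_near_eq (W : normedModType R) (f g : V -> W) x df :
  (\near x, f x = g x) -> is_diff x f df -> is_diff x g df.
Proof.
move=> fg [fx fE].
have gE : g \o shift x = cst (g x) + ('d f x : V -> W) +o_ 0 id.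
  apply/eqaddoP => e e0.
  have /eqaddoP/(_ e e0) := diff_locally fx.
  have fg0 : \forall h \near (0 : V), f (h + x) = g (h + x).
    by have := fg; rewrite (near_shift 0) /= subr0.
  apply: filterS2 fg0 => h fgh.
  by rewrite !fctE /= -(nbhs_singleton fg) -fgh.
have dgE : 'd g x = 'd f x :> (V -> W).
  by apply: diff_unique => //; exact: diff_continuous.
split; last by rewrite dgE.
by apply/diff_locallyP; rewrite dgE; split => //; exact: diff_continuous.
Qed.

Lemma class_C_ext (W : normedModType R) k (U : set V) (f g : V -> W) :
  open U -> (forall x, U x -> f x = g x) -> class_C k U f -> class_C k U g.
Proof.
move=> Uo; elim: k f g => [|k IH] f g fg /=.
  move=> fU x Ux; rewrite /prop_for /continuous_at /= -(fg _ Ux).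
  apply: cvg_trans (fU x Ux); apply: near_eq_cvg.
  by near=> y; rewrite fg //; near: y; exact: open_nbhs_nbhs.
have fgx x : U x -> is_diff x f ('d f x) -> is_diff x g ('d f x).
  move=> Ux; apply: is_diff_near_eq.
  by near=> y; rewrite fg //; near: y; exact: open_nbhs_nbhs.
move=> [fU fdU]; split => [x Ux|v].
  by have [] := fgx x Ux (differentiableP (fU x Ux)).
apply: IH (fdU v) => x Ux.
by have [_ ->] := fgx x Ux (differentiableP (fU x Ux)).
Unshelve. all: by end_near. Qed.

(** The differential of [f] is needed on [U] only, where a formula for it is
    usually at hand; this makes the closure properties below provable by
    induction on [k], since the formula for the differential is built by the
    same operations. *)
Lemma class_C_is_diff (W : normedModType R) k (U : set V) (f : V -> W)
    (df : V -> V -> W) : open U ->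
  (forall x, U x -> is_diff x f (df x)) ->
  (forall v, class_C k U (fun x => df x v)) -> class_C k.+1 U f.
Proof.
move=> Uo fU dfU; split=> [x Ux|v]; first by have [] := fU x Ux.
by apply: class_C_ext (dfU v) => // x Ux; have [_ ->] := fU x Ux.
Qed.

Lemma class_CS (W : normedModType R) k (U : set V) (f : V -> W) :
  class_C k.+1 U f -> class_C k U f.
Proof.
elim: k f => [|k IH] f [fU fdU].
  by move=> x Ux; exact: differentiable_continuous (fU x Ux).
by split=> // v; apply: IH.
Qed.

Lemma class_C_cst (W : normedModType R) k (U : set V) (w : W) :
  open U -> class_C k U (fun _ => w).
Proof.
move=> Uo; elim: k w => [|k IH] w; first by move=> x _; exact: cvg_cst.
exact: (@class_C_is_diff _ _ _ _ (fun _ _ => 0)).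
Qed.

Lemma class_C_linear (W : normedModType R) k (U : set V) (L : {linear V -> W}) :
  open U -> continuous L -> class_C k U L.
Proof.
move=> Uo Lc; case: k => [|k]; first by move=> x _; exact: Lc.
apply: (@class_C_is_diff _ _ _ _ (fun _ => L)) => // [x Ux|v].
  by split; [exact: linear_differentiable|exact: diff_lin].
exact: class_C_cst.
Qed.

Lemma class_C_comp_linear (W W' : normedModType R) k (U : set V) (f : V -> W)
    (L : {linear W -> W'}) :
  open U -> continuous L -> class_C k U f -> class_C k U (L \o f).
Proof.
move=> Uo Lc; elim: k f => [|k IH] f.
  by move=> fU x Ux; apply: continuous_comp; [exact: fU|exact: Lc].
move=> [fU fdU].
apply: (@class_C_is_diff _ _ _ _ (fun x => L \o 'd f x)) => // [x Ux|v].
  apply: is_diff_comp; first exact/differentiableP/fU.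
  by split; [exact: linear_differentiable|exact: diff_lin].
by move: (IH _ (fdU v)).
Qed.

Lemma class_CD (W : normedModType R) k (U : set V) (f g : V -> W) :
  open U -> class_C k U f -> class_C k U g -> class_C k U (fun x => f x + g x).
Proof.
move=> Uo; elim: k f g => [|k IH] f g.
  by move=> fU gU x Ux; apply: cvgD; [exact: fU|exact: gU].
move=> [fU fdU] [gU gdU].
apply: (@class_C_is_diff _ _ _ _ (fun x v => 'd f x v + 'd g x v)) => //.
  move=> x Ux.
  exact: (is_diffD (differentiableP (fU x Ux)) (differentiableP (gU x Ux))).
by move=> v; exact: IH (fdU v) (gdU v).
Qed.

Lemma class_C_sum (W : normedModType R) k (U : set V) I (r : seq I)
    (P : pred I) (f : I -> V -> W) :
  open U -> (forall i, P i -> class_C k U (f i)) ->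
  class_C k U (fun x => \sum_(i <- r | P i) f i x).
Proof.
move=> Uo fU; elim: r => [|i r IH].
  by apply: class_C_ext (class_C_cst k 0 Uo) => // x _; rewrite big_nil.
have [Pi|Pi] := boolP (P i).
  apply: class_C_ext (class_CD Uo (fU i Pi) IH) => // x _.
  by rewrite big_cons Pi.
by apply: class_C_ext IH => // x _; rewrite big_cons (negbTE Pi).
Qed.

Lemma class_CZl (W : normedModType R) k (U : set V) (f : V -> R^o) (w : W) :
  open U -> class_C k U f -> class_C k U (fun x => f x *: w).
Proof.
move=> Uo; elim: k f => [|k IH] f.
  by move=> fU x Ux; apply: cvgZ; [exact: fU|exact: cvg_cst].
move=> [fU fdU].
apply: (@class_C_is_diff _ _ _ _ (fun x v => 'd f x v *: w)) => //.
  by move=> x Ux; split; [exact/differentiableZl/fU|exact/diffZl/fU].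
by move=> v; exact: IH (fdU v).
Qed.

Lemma class_CM k (U : set V) (f g : V -> R^o) :
  open U -> class_C k U f -> class_C k U g ->
  class_C k U (fun x => f x * g x : R^o).
Proof.
move=> Uo; elim: k f g => [|k IH] f g.
  by move=> fU gU x Ux; apply: cvgM; [exact: fU|exact: gU].
move=> fC gC; have [fU fdU] := fC; have [gU gdU] := gC.
apply: (@class_C_is_diff _ _ _ _
    (fun x v => f x * 'd g x v + g x * 'd f x v)) => //.
  move=> x Ux.
  exact: (is_diffM (differentiableP (fU x Ux)) (differentiableP (gU x Ux))).
move=> v; apply: class_CD => //.
  exact: IH (class_CS fC) (gdU v).
exact: IH (class_CS gC) (fdU v).
Qed.

Lemma class_C_prod k (U : set V) I (r : seq I) (f : I -> V -> R^o) :
  open U -> (forall i, class_C k U (f i)) ->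
  class_C k U (fun x => \prod_(i <- r) f i x : R^o).
Proof.
move=> Uo fU; elim: r => [|i r IH].
  by apply: class_C_ext (@class_C_cst R^o k U 1 Uo) => // x _; rewrite big_nil.
by apply: class_C_ext (class_CM Uo (fU i) IH) => // x _; rewrite big_cons.
Qed.

Lemma class_CV k (U : set V) (f : V -> R^o) :
  open U -> (forall x, U x -> f x != 0) -> class_C k U f ->
  class_C k U (fun x => (f x)^-1 : R^o).
Proof.
move=> Uo f0; elim: k => [|k IH].
  by move=> fU x Ux; apply: cvgV; [exact: f0|exact: fU].
move=> fC; have [fU fdU] := fC; have VC := IH (class_CS fC).
apply: (@class_C_is_diff _ _ _ _
    (fun x v => (- 1) * ((f x)^-1 * (f x)^-1) * 'd f x v)) => //.
  move=> x Ux; split; first by apply: differentiableV; auto.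
  rewrite diffV; [|exact: fU|exact: f0].
  by apply/funext => v /=; rewrite mulN1r expr2 invfM.
move=> v; apply: class_CM (fdU v) => //.
by apply: class_CM => //; [exact: class_C_cst|exact: class_CM].
Qed.

Lemma is_diff_comp_derive (f : V -> R^o) (phi : R -> R) x dphi :
  differentiable f x -> is_derive (f x) 1 phi dphi ->
  is_diff x (phi \o f : V -> R^o) (fun v => dphi * 'd f x v).
Proof.
move=> fx [/derivable1_diffP phix phiE].
split; first exact: differentiable_comp.
rewrite diff_comp // diff1E // derive1E phiE.
by apply/funext => v /=; rewrite mulrC.
Qed.

Lemma class_C_atan k (U : set V) (f : V -> R^o) :
  open U -> class_C k U f -> class_C k U (fun x => atan (f x) : R^o).
Proof.
move=> Uo; case: k => [|k].
  move=> fU x Ux; apply: (@continuous_comp _ _ _ f atan); first exact: fU.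
  exact: continuous_atan.
move=> fC; have [fU fdU] := fC.
apply: (@class_C_is_diff _ _ _ _
    (fun x v => (1 + f x ^+ 2)^-1 * 'd f x v)) => //.
  by move=> x Ux; apply: (@is_diff_comp_derive f atan x); exact: fU.
move=> v; apply: class_CM (fdU v) => //; apply: class_CV => //.
  by move=> x _; rewrite gt_eqF // ltr_pwDl // sqr_ge0.
apply: class_CD => //; first exact: class_C_cst.
by apply: class_CM => //; exact: class_CS.
Qed.

(** The derivatives of sine and cosine call for each other, so that the two
    functions are treated together. *)
Lemma class_C_sin_cos k (U : set V) (f : V -> R^o) :
  open U -> class_C k U f ->
  class_C k U (fun x => sin (f x) : R^o) /\
  class_C k U (fun x => cos (f x) : R^o).
Proof.
move=> Uo; elim: k => [|k IH] fC.
  by split=> x Ux; apply: (@continuous_comp _ _ _ f _); [exact: fC| |exact: fC|];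
     [exact: continuous_sin|exact: continuous_cos].
have [sC cC] := IH (class_CS fC); have [fU fdU] := fC; split.
  apply: (@class_C_is_diff _ _ _ _ (fun x v => cos (f x) * 'd f x v)) => //.
    by move=> x Ux; apply: is_diff_comp_derive; first exact: fU.
  by move=> v; exact: class_CM (fdU v).
apply: (@class_C_is_diff _ _ _ _ (fun x v => - sin (f x) * 'd f x v)) => //.
  by move=> x Ux; apply: is_diff_comp_derive; first exact: fU.
move=> v; apply: class_CM (fdU v) => //.
apply: class_C_ext (class_CM Uo (@class_C_cst R^o k U (-1) Uo) sC) => // x _.
by rewrite mulN1r.
Qed.

Lemma class_C_pair (W W' : normedModType R) k (U : set V) (f : V -> W)
    (g : V -> W') : open U ->
  class_C k U f -> class_C k U g -> class_C k U (fun x => (f x, g x)).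
Proof.
move=> Uo; elim: k f g => [|k IH] f g.
  by move=> fU gU x Ux; apply: cvg_pair; [exact: fU|exact: gU].
move=> [fU fdU] [gU gdU].
apply: (@class_C_is_diff _ _ _ _ (fun x v => ('d f x v, 'd g x v))) => //.
  move=> x Ux.
  exact: (is_diff_pair (differentiableP (fU x Ux)) (differentiableP (gU x Ux))).
by move=> v; exact: IH (fdU v) (gdU v).
Qed.

Lemma class_C_coord m p k (U : set V) (M : V -> 'M[R]_(m, p)) i j :
  open U -> class_C k U M -> class_C k U (fun x => M x i j : R^o).
Proof.
move=> Uo MC.
have Llin : linear (fun N : 'M[R]_(m, p) => N i j : R^o).
  by move=> a u v; rewrite !mxE.
pose LM := GRing.isLinear.Build _ _ _ _ _ Llin.
pose L : {linear 'M[R]_(m, p) -> R^o} :=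
  HB.pack (fun N : 'M[R]_(m, p) => N i j : R^o) LM.
exact: (@class_C_comp_linear _ _ _ _ _ L Uo (@coord_continuous _ _ _ i j)).
Qed.

Lemma class_C_mx m p k (U : set V) (M : V -> 'M[R]_(m, p)) :
  open U -> (forall i j, class_C k U (fun x => M x i j : R^o)) ->
  class_C k U M.
Proof.
move=> Uo MC.
apply: (@class_C_ext _ _ _
  (fun x => \sum_i \sum_j M x i j *: delta_mx i j)) => //.
  by move=> x _; rewrite [RHS]matrix_sum_delta.
by apply: class_C_sum => // i _; apply: class_C_sum => // j _; exact: class_CZl.
Qed.

Lemma class_C_mulmx m p r k (U : set V) (M : V -> 'M[R]_(m, p))
    (N : V -> 'M[R]_(p, r)) :
  open U -> class_C k U M -> class_C k U N ->
  class_C k U (fun x => M x *m N x).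
Proof.
move=> Uo MC NC; apply: class_C_mx => // i j.
apply: (@class_C_ext _ _ _ (fun x => \sum_l M x i l * N x l j : R^o)) => //.
  by move=> x _; rewrite mxE.
by apply: class_C_sum => // l _; apply: class_CM => //; exact: class_C_coord.
Qed.

Lemma class_C_det m k (U : set V) (M : V -> 'M[R]_m) :
  open U -> class_C k U M -> class_C k U (fun x => \det (M x) : R^o).
Proof.
move=> Uo MC; apply: class_C_sum => // s _; apply: class_CM => //.
  exact: class_C_cst.
by apply: class_C_prod => // i; exact: class_C_coord.
Qed.

Lemma class_C_invmx m k (U : set V) (M : V -> 'M[R]_m) :
  open U -> (forall x, U x -> M x \in unitmx) -> class_C k U M ->
  class_C k U (fun x => invmx (M x)).
Proof.
move=> Uo Mu MC; apply: class_C_mx => // i j.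
pose minor x := row' j (col' i (M x)).
apply: (@class_C_ext _ _ _ (fun x =>
    (\det (M x))^-1 * ((-1) ^+ (j + i) * \det (minor x)) : R^o)) => //.
  by move=> x Ux; rewrite /invmx Mu // !mxE.
apply: class_CM => //.
  apply: class_CV => // [x Ux|]; last exact: class_C_det.
  by rewrite -unitfE -unitmxE; exact: Mu.
apply: class_CM => //; first exact: class_C_cst.
apply: class_C_det => //; apply: class_C_mx => // a b.
apply: class_C_ext (class_C_coord (lift j a) (lift i b) Uo MC) => // x _.
by rewrite !mxE.
Qed.

Lemma class_C_id k (U : set V) : open U -> class_C k U (fun x : V => x).
Proof.
by move=> Uo; apply: (@class_C_linear _ k U idfun) => // x; exact: cvg_id.
Qed.

End ClassC.

Lemma class_C_fst (R : realType) (V W : normedModType R) k (U : set (V * W)) :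
  open U -> class_C k U (fst : V * W -> V).
Proof.
move=> Uo; apply: (@class_C_linear _ (V * W)%type V k U fst) => // x.
exact: cvg_fst.
Qed.

Lemma class_C_snd (R : realType) (V W : normedModType R) k (U : set (V * W)) :
  open U -> class_C k U (snd : V * W -> W).
Proof.
move=> Uo; apply: (@class_C_linear _ (V * W)%type W k U snd) => // x.
exact: cvg_snd.
Qed.

(** * Upper triangular and signed permutation matrices *)

Section UpperTriangular.
Variables (R : realType) (n : nat).
Local Notation I := 'I_n.+1.
Implicit Types (U : 'M[R]_n.+1) (v : 'rV[R]_n.+1).

Lemma Upplus1 : Upplus (1%:M : 'M[R]_n.+1).
Proof.
split=> [k l lk|k]; rewrite mxE ?eqxx ?ltr01 //.
by have -> : (k == l) = false by apply: gtn_eqF.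
Qed.

Lemma Upplus_mul U U' : Upplus U -> Upplus U' -> Upplus (U *m U').
Proof.
move=> [U0 Up] [U'0 U'p]; split=> [k l lk|k]; rewrite mxE.
  rewrite big1 // => m _; have [mk|km] := ltnP m k; first by rewrite U0 ?mul0r.
  by rewrite U'0 ?mulr0 // (leq_trans lk).
rewrite (bigD1 k) //= big1 ?addr0 ?mulr_gt0 // => m mk.
have [{}mk|km] := ltnP m k; first by rewrite U0 ?mul0r.
by rewrite U'0 ?mulr0 // ltn_neqAle eq_sym mk.
Qed.

Lemma Upplus_delta (r r' : I) (x : R) :
  (r < r')%N -> Upplus (1%:M + x *: delta_mx r r').
Proof.
move=> rr'; split=> [k l lk|k]; rewrite !mxE.
  have -> : (k == l) = false by apply: gtn_eqF.
  rewrite add0r [k == r]eq_sym; case: eqP => [rk|]; last by rewrite mulr0.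
  case: eqP => [lr'|]; last by rewrite mulr0.
  by rewrite -rk lr' ltnNge ltnW in lk.
rewrite eqxx; case: eqP => [->|_]; last by rewrite mulr0 addr0.
by rewrite (_ : r == r' = false) ?mulr0 ?addr0 //; apply: ltn_eqF.
Qed.

Lemma mulmx_Upplus_lead U v (c : I) : Upplus U ->
  (forall x : I, (x < c)%N -> v 0 x = 0) ->
  (forall x : I, (x < c)%N -> (v *m U) 0 x = 0) /\
  (v *m U) 0 c = v 0 c * U c c.
Proof.
move=> [U0 _] v0; split=> [x xc|]; rewrite mxE.
  rewrite big1 // => z _; have [zc|cz] := ltnP z c; first by rewrite v0 ?mul0r.
  by rewrite U0 ?mulr0 // (leq_trans xc).
rewrite (bigD1 c) //= big1 ?addr0 // => z zc.
have [{}zc|cz] := ltnP z c; first by rewrite v0 ?mul0r.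
by rewrite U0 ?mulr0 // ltn_neqAle eq_sym zc.
Qed.

(** Forward substitution, one index after the other; [A] collects the indices at
    which [v] is known to vanish beforehand. *)
Lemma Upplus_forward_subst U v (c : nat) (A : pred I) : Upplus U ->
  (forall x : I, A x -> v 0 x = 0) ->
  (forall x : I, (x < c)%N -> ~~ A x -> (v *m U) 0 x = 0) ->
  forall x : I, (x < c)%N -> v 0 x = 0.
Proof.
move=> UU vA vU x; have [m] := ubnP x; elim: m x => // m IH x xm xc.
have [/vA //|Ax] := boolP (A x).
have lt_x (z : I) : (z < x)%N -> v 0 z = 0.
  by move=> zx; apply: IH; [exact: leq_trans zx _|exact: ltn_trans xc].
have [_ vx] := mulmx_Upplus_lead UU lt_x.
have /eqP := vU x xc Ax; rewrite vx mulf_eq0 => /orP[/eqP //|/eqP Ux].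
by case: UU => _ /(_ x); rewrite Ux ltxx.
Qed.

End UpperTriangular.

Section SignedPermutation.
Variables (R : realType) (n : nat).
Local Notation I := 'I_n.+1.

Definition signed_perm (s : 'S_n.+1) (P : 'M[R]_n.+1) : Prop :=
  exists d : I -> bool,
    P = \matrix_(k, l) (if l == s k then (-1) ^+ d k else 0).

Lemma mul_signed_perm s P m (v : 'M[R]_(m, n.+1)) i x :
  signed_perm s P -> exists d : bool, (v *m P) i (s x) = (-1) ^+ d * v i x.
Proof.
move=> [d ->]; exists (d x); rewrite mxE (bigD1 x) //= big1 ?addr0.
  by rewrite mxE eqxx mulrC.
by move=> y yx; rewrite mxE (inj_eq perm_inj) eq_sym (negbTE yx) mulr0.
Qed.

Lemma mul_signed_perm_eq0 s P m (v : 'M[R]_(m, n.+1)) i x :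
  signed_perm s P -> ((v *m P) i (s x) == 0) = (v i x == 0).
Proof.
by move=> /(mul_signed_perm v i x)[d ->]; rewrite mulf_eq0 signr_eq0.
Qed.

Lemma signed_perm_mul s t P Q :
  signed_perm s P -> signed_perm t Q -> signed_perm (s * t)%g (P *m Q).
Proof.
move=> [d ->] [d' ->]; exists (fun k => d k (+) d' (s k)).
apply/matrixP => k l; rewrite mxE (bigD1 (s k)) //= big1 ?addr0; last first.
  by move=> m /negbTE mk; rewrite mxE mk mul0r.
rewrite !mxE eqxx permM; case: ifP; rewrite ?mulr0 //.
by rewrite signr_addb.
Qed.

(** Conjugation by a signed permutation matrix turns the elementary matrix at
    [(s r, s r')] into the one at [(r, r')], up to sign. *)
Lemma signed_perm_delta s P (r r' : I) (x : R) : signed_perm s P ->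
  exists y : R, P *m (1%:M + x *: delta_mx (s r) (s r')) =
    (1%:M + y *: delta_mx r r') *m P.
Proof.
move=> [d PE]; exists (x * (-1) ^+ d r * (-1) ^+ d r').
rewrite mulmxDl mulmxDr mul1mx mulmx1; congr (_ + _).
rewrite -scalemxAl -scalemxAr; apply/matrixP => k l; rewrite !mxE.
rewrite (bigD1 (s r)) //= big1 ?addr0; last first.
  by move=> m /negbTE mr; rewrite !mxE mr mulr0.
rewrite (bigD1 r') //= big1 ?addr0; last first.
  by move=> m /negbTE mr; rewrite !mxE mr andbF mul0r.
rewrite PE !mxE (inj_eq perm_inj) !eqxx andbT [k == r]eq_sym.
case: (r =P k) => [<-|_]; last by rewrite !mul0r !mulr0.
case: ifP => _ /=; rewrite ?mulr0 // mulr1 mul1r.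
by rewrite -!mulrA -expr2 sqrr_sign mulr1.
Qed.

End SignedPermutation.

(** * Rotations in a coordinate plane *)

Section Rotations.
Variables (R : realType) (n : nat) (j : 'I_n).
Local Notation I := 'I_n.+1.
Local Notation a := (idx j).
Local Notation b := (idxS j).

Definition rot (t : R) : 'M[R]_n.+1 :=
  1%:M + (cos t - 1) *: (delta_mx a a + delta_mx b b) + sin t *: so_gen R j.

Lemma idxSE : (b = j.+1 :> nat) * (a = j :> nat). Proof. by []. Qed.

Lemma idx_lt : (a < b)%N. Proof. by rewrite !idxSE. Qed.

Lemma idx_neq : (a == b) = false. Proof. by apply: ltn_eqF; exact: idx_lt. Qed.

Lemma mulmx_delta m p q (X : 'M[R]_(m, p)) (x : 'I_p) (y : 'I_q) k l :
  (X *m delta_mx x y) k l = X k x * (l == y)%:R.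
Proof.
rewrite mxE (bigD1 x) //= big1 ?addr0 ?mxE ?eqxx //.
by move=> z /negbTE zx; rewrite mxE zx mulr0.
Qed.

Lemma delta_mulmx m p q (X : 'M[R]_(p, m)) (y : 'I_q) (x : 'I_p) l k :
  (delta_mx y x *m X) l k = (l == y)%:R * X x k.
Proof.
rewrite mxE (bigD1 x) //= big1 ?addr0 ?mxE ?eqxx ?andbT //.
by move=> z /negbTE zx; rewrite mxE zx andbF mul0r.
Qed.

Lemma mulmx_rot m (X : 'M[R]_(m, n.+1)) t k l :
  (X *m rot t) k l = if l == a then X k a * cos t + X k b * sin t
    else if l == b then X k b * cos t - X k a * sin t else X k l.
Proof.
rewrite /rot /so_gen !mulmxDr mulmx1 -!scalemxAr mulmxDr mulmxBr.
have D x y := @mulmx_delta m _ _ X x y k l.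
move: (D a a) (D b b) (D b a) (D a b).
move: (X *m delta_mx a a) (X *m delta_mx b b) (X *m delta_mx b a).
move: (X *m delta_mx a b) => Mab Maa Mbb Mba.
rewrite !mxE => -> -> -> ->.
case: (eqVneq l a) => [->|la]; first by rewrite idx_neq /=; ring.
by case: (eqVneq l b) => [->|lb] /=; ring.
Qed.

Lemma rot_mulmx m (X : 'M[R]_(n.+1, m)) t k l :
  (rot t *m X) k l = if k == a then cos t * X a l - sin t * X b l
    else if k == b then sin t * X a l + cos t * X b l else X k l.
Proof.
rewrite /rot /so_gen !mulmxDl mul1mx -!scalemxAl mulmxDl mulmxBl.
have D x y := @delta_mulmx m _ _ X x y k l.
move: (D a a) (D b b) (D b a) (D a b).
move: (delta_mx a a *m X) (delta_mx b b *m X) (delta_mx b a *m X).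
move: (delta_mx a b *m X) => Mab Maa Mbb Mba.
rewrite !mxE => -> -> -> ->.
case: (eqVneq k a) => [->|ka]; first by rewrite idx_neq /=; ring.
by case: (eqVneq k b) => [->|kb] /=; ring.
Qed.

Lemma rotE t k l : rot t k l =
  if l == a then (k == a)%:R * cos t + (k == b)%:R * sin t
  else if l == b then (k == b)%:R * cos t - (k == a)%:R * sin t
  else (k == l)%:R.
Proof. by rewrite -[rot t]mul1mx mulmx_rot !mxE. Qed.

Lemma rotD t u : rot t *m rot u = rot (t + u).
Proof.
apply/matrixP => k l; rewrite mulmx_rot !rotE !eqxx cosD sinD.
rewrite [b == a]eq_sym idx_neq.
by case: (eqVneq l a) => _; [ring|case: (eqVneq l b) => _ //; ring].
Qed.

Lemma rot0 : rot 0 = 1%:M.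
Proof. by rewrite /rot cos0 sin0 subrr !scale0r !addr0. Qed.

Lemma trmx_rot t : (rot t)^T = rot (- t).
Proof.
apply/matrixP => k l; rewrite /rot /so_gen !mxE cosN sinN.
by rewrite ![(l == _) && _]andbC [l == k]eq_sym; ring.
Qed.

Lemma rot_SO t : SO (rot t).
Proof.
have O u : (rot u)^T *m rot u = 1%:M by rewrite trmx_rot rotD addNr rot0.
split=> //; rewrite [t]splitr -rotD det_mulmx -{1}det_tr -det_mulmx O.
exact: det1.
Qed.

Lemma SO_mul (Q Q' : 'M[R]_n.+1) : SO Q -> SO Q' -> SO (Q *m Q').
Proof.
move=> [QO Q1] [QO' Q1']; split; last by rewrite det_mulmx Q1 Q1' mulr1.
by rewrite trmx_mul mulmxA -(mulmxA Q'^T) QO mulmx1.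
Qed.

End Rotations.

(** * One step in the Bruhat decomposition *)

Lemma mul_elem_mx (R : realType) m p (x : R) (r r' : 'I_m) (X : 'M[R]_(m, p)) k l :
  ((1%:M + x *: delta_mx r r') *m X) k l = X k l + x * ((k == r)%:R * X r' l).
Proof.
rewrite mulmxDl mul1mx -scalemxAl -delta_mulmx.
by move: (delta_mx _ _ *m X) => Y; rewrite !mxE.
Qed.

Lemma ord_between n (j : 'I_n) (k : 'I_n.+1) :
  k != idx j -> k != idxS j -> (k < idx j)%N \/ (idxS j < k)%N.
Proof.
move=> ka kb; have ka' : (k != j :> nat) := ka.
have kb' : (k != j.+1 :> nat) := kb.
by rewrite !idxSE; lia.
Qed.

Section BruhatStep.
Variables (R : realType) (n : nat) (j : 'I_n).
Local Notation I := 'I_n.+1.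
Local Notation a := (idx j).
Local Notation b := (idxS j).
Variables (e t : R).
Hypotheses (e2 : e * e = 1) (t0 : 0 < t) (tpi : t < pi).

Let s := sin t.
Let c := cos t.

Lemma sin_step_gt0 : 0 < s. Proof. by apply: sin_gt0_pi; rewrite t0. Qed.

Lemma sin_sign u : sin (e * u) = e * sin u.
Proof.
have /eqP : e ^+ 2 = 1 by rewrite expr2.
by rewrite sqrf_eq1 => /orP[]/eqP ->; rewrite ?mul1r ?mulN1r ?sinN.
Qed.

Lemma cos_sign u : cos (e * u) = cos u.
Proof.
have /eqP : e ^+ 2 = 1 by rewrite expr2.
by rewrite sqrf_eq1 => /orP[]/eqP ->; rewrite ?mul1r ?mulN1r ?cosN.
Qed.

(** For [0 < t < pi] the lower left entry of a rotation by [t] is not zero, so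
    that the rotation lies in the big cell of SL_2, whose representative is the
    rotation by [pi / 2].  Row [a] of the upper triangular factor on the right
    is [e] times row [b] of [U *m rot j (e * t)], whose entries at [a] and [b]
    are proportional to [e * sin t] and [cos t]: it remembers [t]. *)
Lemma Upplus_rot (U : 'M[R]_n.+1) : Upplus U ->
  exists (x : R) (U' : 'M[R]_n.+1), [/\ Upplus U',
    U *m rot j (e * t) =
      (1%:M + x *: delta_mx a b) *m rot j (e * (pi / 2)) *m U'
    & U' a b * s = e * c * U' a a].
Proof.
move=> [U0 Up]; have s0 := sin_step_gt0.
have e0 : e != 0.
  by apply/eqP => E; move/eqP: e2; rewrite E mul0r eq_sym oner_eq0.
set G := U *m rot j (e * t).
have GE k l : G k l = if l == a then U k a * c + U k b * (e * s)
    else if l == b then U k b * c - U k a * (e * s) else U k l.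
  by rewrite mulmx_rot cos_sign sin_sign.
have Uba : U b a = 0 by apply: U0; exact: idx_lt.
have ba : (b == a) = false by rewrite eq_sym idx_neq.
have Ua := Up a; have Ub := Up b.
(* [x] is the multiple of row [b] of [G] that clears the entry of [G] at
   [(a, a)]; the rotation by [pi / 2] then exchanges the two rows. *)
pose x := (U a a * c + U a b * (e * s)) / (U b b * (e * s)).
pose U' : 'M[R]_n.+1 := \matrix_(k, l) (if k == a then e * G b l
  else if k == b then - e * (G a l - x * G b l) else G k l).
have G0 (k l : I) : (l < k)%N -> (l < a)%N -> G k l = 0.
  move=> lk la; rewrite GE.
  have -> : (l == a) = false by apply: ltn_eqF.
  have -> : (l == b) = false by apply: ltn_eqF; rewrite (ltn_trans la) ?idx_lt.
  exact: U0.
have Gaa : G a a = U a a * c + U a b * (e * s) by rewrite GE eqxx.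
have Gba : G b a = U b b * (e * s) by rewrite GE eqxx Uba mul0r add0r.
have Gab : G a b = U a b * c - U a a * (e * s) by rewrite GE ba eqxx.
have Gbb : G b b = U b b * c by rewrite GE ba eqxx Uba mul0r subr0.
have U'E k l : U' k l = if k == a then e * G b l
    else if k == b then - e * (G a l - x * G b l) else G k l by rewrite [LHS]mxE.
exists x, U'; split.
- split=> [k l lk|k].
    rewrite U'E; case: (eqVneq k a) => [ka|ka].
      rewrite ka in lk; rewrite G0 ?mulr0 // (ltn_trans lk) // idx_lt //.
    case: (eqVneq k b) => [kb|kb].
      rewrite kb in lk; case: (eqVneq l a) => [->|la].
        by rewrite Gaa Gba /x divfK ?subrr ?mulr0 // !mulf_neq0 // gt_eqF.
      have la' : (l < a)%N.
        have lb : l != b by rewrite neq_ltn lk.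
        by case: (ord_between la lb) => //; rewrite ltnNge ltnW.
      by rewrite !G0 ?mulr0 ?subrr ?mulr0.
    have [kLa|bLk] := ord_between ka kb.
      by apply: G0 => //; exact: ltn_trans kLa.
    rewrite GE !(U0 k) ?(ltn_trans (idx_lt j)) // !mul0r addr0 subr0.
    by do 2!case: ifP => // _; exact: U0.
  rewrite U'E; case: (eqVneq k a) => [->|ka].
    rewrite Gba (_ : _ * _ = e * e * (U b b * s)); last by ring.
    by rewrite e2 mul1r mulr_gt0.
  case: (eqVneq k b) => [->|kb].
    rewrite Gab Gbb /x.
    have -> : - e * (U a b * c - U a a * (e * s) -
        (U a a * c + U a b * (e * s)) / (U b b * (e * s)) * (U b b * c)) =
        U a a * (c ^+ 2 + s ^+ 2) / s.
      have E : e ^+ 2 = 1 by rewrite expr2.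
      have -> : - e * (U a b * c - U a a * (e * s) -
        (U a a * c + U a b * (e * s)) / (U b b * (e * s)) * (U b b * c)) =
        U a a * (c ^+ 2 + e ^+ 2 * s ^+ 2) / s.
        by field; rewrite e0 !gt_eqF.
      by rewrite E mul1r.
    by rewrite /c /s cos2Dsin2 mulr1 divr_gt0.
  by rewrite GE (negbTE ka) (negbTE kb).
- apply/matrixP => k l; rewrite -/G -mulmxA mul_elem_mx !rot_mulmx.
  rewrite cos_sign sin_sign cos_pihalf sin_pihalf mulr1 ba eqxx !U'E eqxx ba eqxx.
  rewrite !mul0r sub0r addr0.
  case: (eqVneq k a) => [->|ka].
    rewrite [RHS](_ : _ = e * e * G a l); last by rewrite /=; ring.
    by rewrite e2 mul1r.
  rewrite mul0r mulr0 addr0; case: (eqVneq k b) => [->|kb //].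
  by rewrite mulrA e2 mul1r.
- rewrite !U'E eqxx Gbb Gba.
  rewrite [RHS](_ : _ = e * e * (e * (U b b * c) * s)); last by ring.
  by rewrite e2 mul1r.
Qed.

(** The hypothesis says that the rotation on the right clears the entry of [U] at
    [(a, a)]; after the exchange of rows [a] and [b] by the rotation by [pi / 2],
    the result is upper triangular. *)
Lemma rot_Upplus_rot (U : 'M[R]_n.+1) : Upplus U ->
  U a a * c = e * s * U a b ->
  Upplus (rot j (e * (pi / 2)) *m U *m rot j (- (e * t))).
Proof.
move=> [U0 Up] Uab; have s0 := sin_step_gt0.
have Uba : U b a = 0 by apply: U0; exact: idx_lt.
have ba : (b == a) = false by rewrite eq_sym idx_neq.
rewrite -mulmxA; set H := U *m rot j (- (e * t)).
have HE k l : H k l = if l == a then U k a * c - U k b * (e * s)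
    else if l == b then U k b * c + U k a * (e * s) else U k l.
  by rewrite mulmx_rot cosN sinN cos_sign sin_sign !mulrN opprK.
have E k l : (rot j (e * (pi / 2)) *m H) k l =
    if k == a then - (e * H b l) else if k == b then e * H a l else H k l.
  rewrite rot_mulmx cos_sign sin_sign cos_pihalf sin_pihalf mulr1 !mul0r.
  by rewrite sub0r addr0.
have H0 (k l : I) : (l < k)%N -> (l < a)%N -> H k l = 0.
  move=> lk la; rewrite HE.
  have -> : (l == a) = false by apply: ltn_eqF.
  have -> : (l == b) = false by apply: ltn_eqF; rewrite (ltn_trans la) ?idx_lt.
  exact: U0.
have Haa : H a a = 0 by rewrite HE eqxx Uab; ring.
split=> [k l lk|k]; rewrite E.
  case: (eqVneq k a) => [ka|ka].
    by rewrite ka in lk; rewrite H0 ?mulr0 ?oppr0 // (ltn_trans lk) // idx_lt.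
  case: (eqVneq k b) => [kb|kb].
    rewrite kb in lk; case: (eqVneq l a) => [->|la]; first by rewrite Haa mulr0.
    have la' : (l < a)%N.
      have lb : l != b by rewrite neq_ltn lk.
      by case: (ord_between la lb) => //; rewrite ltnNge ltnW.
    by rewrite H0 ?mulr0.
  have [kLa|bLk] := ord_between ka kb.
    by apply: H0 => //; exact: ltn_trans kLa.
  rewrite HE !(U0 k) ?(ltn_trans (idx_lt j)) // !mul0r addr0 subr0.
  by do 2!case: ifP => // _; exact: U0.
case: (eqVneq k a) => [->|ka].
  rewrite HE eqxx Uba (_ : - _ = e * e * (U b b * s)); last by ring.
  by rewrite e2 mul1r mulr_gt0.
case: (eqVneq k b) => [->|kb].
  rewrite HE ba eqxx -(pmulr_lgt0 _ s0).
  have -> : e * (U a b * c + U a a * (e * s)) * s =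
      c * (e * s * U a b) + e * e * U a a * s ^+ 2 by ring.
  rewrite -Uab e2 [X in 0 < X](_ : _ = U a a * (c ^+ 2 + s ^+ 2)); last by ring.
  by rewrite /c /s cos2Dsin2 mulr1.
by rewrite HE (negbTE ka) (negbTE kb).
Qed.

(** The elementary factor that [Upplus_rot] leaves on the left of the rotation
    by [pi / 2] can be moved to the left of [P], where it becomes elementary at
    [(sg^-1 a, sg^-1 b)].  It is upper triangular there because the inequality
    between these two indices says that multiplying [sg] by the transposition
    increases the length. *)
Lemma bruhat_cell_rot (sg : 'S_n.+1) (P Q : 'M[R]_n.+1) : signed_perm sg P ->
  ((sg^-1)%g a < (sg^-1)%g b)%N -> bruhat_cell P Q ->
  exists U1 U2, [/\ Upplus U1, Upplus U2,
    Q *m rot j (e * t) = U1 *m (P *m rot j (e * (pi / 2))) *m U2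
    & U2 a b * s = e * c * U2 a a].
Proof.
move=> PE sab [U1 [U2 [U1p U2p ->]]].
have [x [U' [U'p U'E U'ab]]] := Upplus_rot U2p.
have := signed_perm_delta ((sg^-1)%g a) ((sg^-1)%g b) x PE.
rewrite !permKV => -[y Py].
exists (U1 *m (1%:M + y *: delta_mx ((sg^-1)%g a) ((sg^-1)%g b))), U'.
split=> //; first by apply: Upplus_mul => //; exact: Upplus_delta.
by rewrite -!mulmxA U'E !mulmxA -(mulmxA U1 P) Py !mulmxA.
Qed.

Lemma bruhat_cell_rotV (P U1 U2 : 'M[R]_n.+1) : Upplus U1 -> Upplus U2 ->
  U2 a a * c = e * s * U2 a b ->
  bruhat_cell P (U1 *m (P *m rot j (e * (pi / 2))) *m U2 *m rot j (- (e * t))).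
Proof.
move=> U1p U2p U2ab.
exists U1, (rot j (e * (pi / 2)) *m U2 *m rot j (- (e * t))).
by split=> //; [exact: rot_Upplus_rot|rewrite !mulmxA].
Qed.

End BruhatStep.

(** * The angle as a rational function on a cell *)

Section Ratio.
Variables (R : realType) (n : nat) (j : 'I_n) (sg : 'S_n.+1).
Local Notation I := 'I_n.+1.
Local Notation a := (idx j).
Local Notation b := (idxS j).

(** The columns of [Q] up to [a], completed by the basis vectors with indices
    that [sg] sends after [a].  If [Q] is in the cell of a signed permutation
    matrix for [sg], then these vectors form a basis. *)
Definition flag_mx (Q : 'M[R]_n.+1) : 'M[R]_n.+1 :=
  \matrix_(x, y) (if (y <= a)%N then Q x y else (sg x == y)%:R).

(** The row of index [a] of [invmx (flag_mx Q)] is the linear form that vanishes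
    on the columns of [Q] before [a] and on the added basis vectors, and is [1]
    on column [a] of [Q]; it is evaluated at column [b].  By Cramer's rule this
    is a quotient of two minors of [Q]. *)
Definition cell_ratio (Q : 'M[R]_n.+1) : R := (invmx (flag_mx Q) *m Q) a b.

Variables (P U1 U2 : 'M[R]_n.+1).
Hypotheses (PE : signed_perm sg P) (U1p : Upplus U1) (U2p : Upplus U2).
Let Q := U1 *m P *m U2.

Lemma mul_flag_mx (v : 'rV[R]_n.+1) (y : I) :
  (v *m flag_mx Q) 0 y =
  if (y <= a)%N then (v *m Q) 0 y else v 0 ((sg^-1)%g y).
Proof.
rewrite mxE; case: ifPn => ya.
  by rewrite [RHS]mxE; apply: eq_bigr => x _; rewrite mxE ya.
rewrite (bigD1 ((sg^-1)%g y)) //= big1 ?addr0.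
  by rewrite mxE (negbTE ya) permKV eqxx mulr1.
move=> x xy; rewrite mxE (negbTE ya); case: eqP => [E|]; last by rewrite mulr0.
by rewrite -E permK eqxx in xy.
Qed.

Lemma mul_cell_eq0 (v : 'rV[R]_n.+1) (c : nat) :
  (forall y : I, (y < c)%N -> (v *m Q) 0 y = 0) ->
  forall x : I, (sg x < c)%N -> (v *m U1) 0 x = 0.
Proof.
move=> vQ x xc; apply/eqP; rewrite -(mul_signed_perm_eq0 _ _ x PE); apply/eqP.
apply: (@Upplus_forward_subst _ _ U2 _ c pred0) => // y yc _.
by have := vQ y yc; rewrite /Q !mulmxA.
Qed.

(** A row [v] of the left kernel has [v *m U1] zero at the indices that [sg]
    sends up to [a], and is itself zero at the other ones; as [U1] is upper
    triangular, the first nonzero entry of [v] would contradict this. *)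
Lemma flag_mx_unit : flag_mx Q \in unitmx.
Proof.
rewrite -row_free_unit -kermx_eq0; apply/rowV0P => v /sub_kermxP vK.
have vy (y : I) : (if (y <= a)%N then (v *m Q) 0 y else v 0 ((sg^-1)%g y)) = 0.
  by rewrite -mul_flag_mx vK mxE.
have vU1 : forall x : I, (sg x < a.+1)%N -> (v *m U1) 0 x = 0.
  by apply: mul_cell_eq0 => y ya; have := vy y; rewrite -ltnS ya.
apply/rowP => x; rewrite [RHS]mxE.
apply: (@Upplus_forward_subst _ _ U1 _ n.+1 (fun x => ~~ (sg x <= a)%N)) => //.
  by move=> y /negbTE ya; have := vy (sg y); rewrite ya permK.
by move=> y _; rewrite negbK -ltnS => /vU1.
Qed.

(** Although [U2] is not determined by [Q], the direction of the first row that
    the rotation touches is.  The linear form [v] that defines [cell_ratio] is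
    supported on the indices from [sg^-1 a] on, because of the first nonzero
    entry again; hence [w = v *m U1 *m P] vanishes before [a] and, since
    [sg^-1 b] comes before [sg^-1 a], at [b] too.  So [v *m Q] is at [a] and [b]
    a multiple of row [a] of [U2]. *)
Lemma cell_ratioE : ((sg^-1)%g b < (sg^-1)%g a)%N ->
  cell_ratio Q * U2 a a = U2 a b.
Proof.
move=> rr'; pose v := row a (invmx (flag_mx Q)).
have vK : v *m flag_mx Q = row a 1%:M.
  by rewrite -row_mul mulVmx ?flag_mx_unit.
have vy (y : I) : (if (y <= a)%N then (v *m Q) 0 y else v 0 ((sg^-1)%g y)) =
    (a == y)%:R.
  by rewrite -mul_flag_mx vK !mxE.
have vQ (y : I) : (y < a)%N -> (v *m Q) 0 y = 0.
  move=> ya; have := vy y; rewrite ltnW // => ->.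
  by have -> : (a == y) = false by apply: gtn_eqF.
have vU1 := mul_cell_eq0 vQ.
have vr' (x : I) : (x < (sg^-1)%g a)%N -> v 0 x = 0.
  apply: (@Upplus_forward_subst _ _ U1 _ _ (fun x => (a < sg x)%N)) => // y.
    move=> ay; have := vy (sg y); rewrite leqNgt ay /= permK => ->.
    by have -> : (a == sg y) = false by apply: ltn_eqF.
  move=> yr'; rewrite -leqNgt leq_eqVlt => /orP[/eqP sy|/vU1 //].
  by rewrite -(val_inj sy) permK ltnn in yr'.
have [vU1r _] := mulmx_Upplus_lead U1p vr'.
pose w := v *m U1 *m P.
have wQ : v *m Q = w *m U2 by rewrite /w /Q !mulmxA.
have wb : w 0 b = 0.
  by apply/eqP; rewrite -[b](permKV sg) mul_signed_perm_eq0 // vU1r.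
have wlt (y : I) : (y < a)%N -> w 0 y = 0.
  move=> ya; apply/eqP; rewrite -[y](permKV sg) mul_signed_perm_eq0 //.
  by rewrite vU1 // permKV.
have wa : w 0 a * U2 a a = 1.
  have := vy a; rewrite leqnn eqxx wQ.
  by have [_ ->] := mulmx_Upplus_lead U2p wlt.
have -> : cell_ratio Q = w 0 a * U2 a b.
  have -> : cell_ratio Q = (v *m Q) 0 b.
    by rewrite /v -row_mul [RHS]mxE.
  rewrite wQ mxE (bigD1 a) //= big1 ?addr0 // => y ya.
  have [->|yb] := eqVneq y b; first by rewrite wb mul0r.
  have [yLa|bLy] := ord_between ya yb; first by rewrite wlt ?mul0r.
  by case: U2p => U20 _; rewrite U20 ?mulr0.
by rewrite mulrAC wa mul1r.
Qed.

End Ratio.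

(** * The spin group *)

Section SpinElements.
Variables (R : realType) (n : nat).
Local Notation I := 'I_n.+1.
Local Notation Cl := 'M[R]_#|{set 'I_n.+1}|.
Local Notation gen := (@gen R n).
Implicit Types (z y : Cl).

(** [J] behaves like the imaginary unit, so that the exponential series splits
    into the cosine and the sine series, as in Euler's formula. *)
Lemma mexp_complex_unit p (J : 'M[R]_p) (x : R) : J *m J = - 1%:M ->
  mexp (x *: J) = cos x *: 1%:M + sin x *: J.
Proof.
move=> J2; apply: cvg_lim; first exact: norm_hausdorff.
have JX k : J ^+ k = (~~ odd k)%:R * (-1) ^+ k./2 *: 1%:M +
    (odd k)%:R * (-1) ^+ k.-1./2 *: J.
  elim/ltn_ind: k => [[_|[_|k IH]]].
  - by rewrite /= !expr0 !mulr1 scale1r scale0r addr0.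
  - by rewrite /= expr1 !expr0 !mulr1 scale1r scale0r add0r.
  - rewrite (exprS J) (exprS J) mulrA -[J * J]/(J *m J) J2 mulN1r IH //= negbK.
    rewrite opprD -[- (_ *: 1%:M)]scaleNr -[- (_ *: J)]scaleNr !negbK.
    congr (_ *: _ + _ *: _).
      by rewrite exprS; ring.
    by case: k {IH} => [|k] /=; rewrite ?exprS; ring.
have xJX k : (x *: J) ^+ k = x ^+ k *: J ^+ k.
  elim: k => [|k IH]; first by rewrite !expr0 scale1r.
  rewrite !exprS IH -[LHS]/((x *: J) *m (x ^+ k *: J ^+ k)).
  by rewrite -scalemxAl -scalemxAr scalerA.
have -> : series (fun k => (k`!%:R)^-1 *: (x *: J) ^+ k) =
    (fun m => series (cos_coeff x) m *: 1%:M + series (sin_coeff x) m *: J).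
  apply/funext => m; rewrite /series /= !scaler_suml -big_split /=.
  apply: eq_bigr => k _.
  rewrite xJX JX !scalerDr !scalerA /cos_coeff /sin_coeff /=.
  by congr (_ *: _ + _ *: _); rewrite -?exprnP; ring.
rewrite cos.unlock sin.unlock; apply: cvgD.
  by apply: cvgZ; [exact: is_cvg_series_cos_coeff|exact: cvg_cst].
by apply: cvgZ; [exact: is_cvg_series_sin_coeff|exact: cvg_cst].
Qed.

Definition plane (j : 'I_n) : Cl := gen (idx j) *m gen (idxS j).

Lemma gen_anticomm k l : k != l -> gen k *m gen l = - (gen l *m gen k).
Proof.
move=> /negbTE kl; have := gen_comm R k l.
rewrite kl mul0rn oppr0 -scalemx1 scale0r => /eqP.
by rewrite addr_eq0 => /eqP.
Qed.

Lemma plane_sqr j : plane j *m plane j = - 1%:M.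
Proof.
rewrite /plane -mulmxA [gen (idxS j) *m _]mulmxA.
rewrite [gen (idxS j) *m gen (idx j)]gen_anticomm; last by rewrite eq_sym idx_neq.
rewrite mulNmx mulmxN -!mulmxA gen_sqr !mulmxA gen_sqr.
by rewrite -scalar_mxM mulrNN mulr1.
Qed.

Lemma alphaE j t : alpha j t = cos (t / 2) *: 1%:M + sin (t / 2) *: plane j.
Proof.
rewrite /alpha -mexp_complex_unit ?plane_sqr //; congr mexp.
rewrite -scalerA; congr (_ *: _).
rewrite /so_lift (bigD1 (idx j)) //= (bigD1 (idxS j)) //= big1 ?addr0; last first.
  by move=> l /negbTE lb; rewrite /so_gen !mxE lb eqxx idx_neq andbF subrr scale0r.
rewrite (bigD1 (idxS j)) /=; last by rewrite eq_sym idx_neq.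
rewrite [X in _ + (_ + X)]big1 ?addr0; last first.
  move=> k /andP[/negbTE ka /negbTE kb]; rewrite big1 // => l _.
  by rewrite /so_gen !mxE ka kb !andbF subrr scale0r.
rewrite (bigD1 (idx j)) //= [X in _ + (_ + X)]big1 ?addr0; last first.
  move=> l /negbTE la; rewrite /so_gen !mxE la.
  by rewrite [idxS j == idx j]eq_sym idx_neq andbF subrr scale0r.
rewrite /so_gen !mxE !eqxx [idxS j == idx j]eq_sym !idx_neq /= subr0 sub0r.
rewrite scale1r [gen (idxS j) *m _]gen_anticomm; last by rewrite eq_sym idx_neq.
rewrite scaleNr scale1r opprK -/(plane j) -mulr2n.
rewrite -[plane j *+ 2]scaler_nat scalerA.
by congr (_ *: _); field.
Qed.

Lemma plane_mul j (p q r s : R) :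
  (p *: 1%:M + q *: plane j) *m (r *: 1%:M + s *: plane j) =
  (p * r - q * s) *: 1%:M + (p * s + q * r) *: plane j.
Proof.
rewrite mulmxDl !mulmxDr -!scalemxAl -!scalemxAr !mul1mx !mulmx1 plane_sqr.
rewrite scalerBl scalerDl !scalerA !scalerN -!scalerA.
by rewrite addrACA [X in _ + X]addrC addrACA; congr (_ + _); exact: addrC.
Qed.

Lemma alphaD j t u : alpha j t *m alpha j u = alpha j (t + u) :> Cl.
Proof. by rewrite !alphaE plane_mul mulrDl cosD sinD [cos _ * sin _ + _]addrC. Qed.

Lemma alpha0 j : alpha j 0 = 1%:M :> Cl.
Proof. by rewrite alphaE mul0r cos0 sin0 scale1r scale0r addr0. Qed.

Lemma alpha_unit j t : (alpha j t : Cl) \in unitmx.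
Proof. by have /mulmx1_unit[] : alpha j t *m alpha j (- t) = 1%:M :> Cl
  by rewrite alphaD subrr alpha0. Qed.

Lemma invmx_alpha j t : invmx (alpha j t) = alpha j (- t) :> Cl.
Proof.
apply: (can_inj (mulKmx (alpha_unit j t))).
by rewrite mulmxV ?alpha_unit // alphaD subrr alpha0.
Qed.

Lemma zpow_acute j (eps : int) : eps = 1 \/ eps = -1 ->
  zpowmx (acute R j) eps = alpha j (eps%:~R * (pi / 2)) :> Cl.
Proof.
case=> -> /=; first by rewrite expr1 mul1r.
by rewrite expr1 invmx_alpha mulN1r.
Qed.

Lemma Spin1 : Spin (1%:M : Cl).
Proof. by exists [::]; split=> //; rewrite big_nil. Qed.

Lemma Spin_mul z y : Spin z -> Spin y -> Spin (z *m y).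
Proof.
move=> [s [so s1 ->]] [r [ro r1 ->]]; exists (s ++ r); split.
- by rewrite size_cat oddD (negbTE so) (negbTE ro).
- by move=> v; rewrite mem_cat => /orP[/s1|/r1].
- by rewrite big_cat.
Qed.

(** A rotation of the plane of the two basis vectors is the product of two
    reflections, in lines that meet at half its angle. *)
Lemma Spin_alpha j t : Spin (alpha j t : Cl).
Proof.
pose da : 'cV[R]_n.+1 := delta_mx (idx j) 0.
pose db : 'cV[R]_n.+1 := delta_mx (idxS j) 0.
exists [:: - da; cos (t / 2) *: da - sin (t / 2) *: db]; split=> //.
- move=> v; rewrite !inE => /orP[]/eqP ->.
    rewrite (bigD1 (idx j)) //= big1 ?addr0; first by rewrite !mxE !eqxx sqrrN expr1n.
    by move=> k /negbTE kj; rewrite !mxE kj oppr0 expr0n.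
  rewrite (bigD1 (idx j)) //= (bigD1 (idxS j)) /=; last by rewrite eq_sym idx_neq.
  rewrite big1 ?addr0; last first.
    by move=> k /andP[/negbTE ka /negbTE kb]; rewrite !mxE ka kb !mulr0 subrr expr0n.
  rewrite !mxE !eqxx [idxS j == _]eq_sym idx_neq /= !mulr1 !mulr0 subr0 sub0r.
  by rewrite sqrrN cos2Dsin2.
- rewrite !big_cons big_nil mulr1 linearN linearB !linearZ /= !clv_delta.
  rewrite -[_ * _]/(_ *m _) mulNmx mulmxDr -!scalemxAr mulmxN gen_sqr.
  by rewrite -/(plane j) alphaE opprD raddfN /= !scalerN !opprK.
Qed.

(** The generators are signed permutation matrices of square [-1], hence
    antisymmetric; this is what makes the elements of [Spin] orthogonal. *)
Lemma trmx_gen k : (gen k)^T = - gen k.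
Proof.
apply/matrixP => x y; rewrite !mxE.
have E A B : (A == flip k B) = (B == flip k A).
  by apply/eqP/eqP => ->; rewrite flipK.
rewrite E; case: eqP => [->|_]; last by rewrite oppr0.
rewrite -[LHS]signr_odd -[in RHS]signr_odd odd_flip leqnn addbT.
by rewrite signrN.
Qed.

Lemma trmx_clv (v : 'cV[R]_n.+1) : (clv v)^T = - clv v.
Proof.
rewrite /clv linear_sum /= -sumrN; apply: eq_bigr => k _.
by rewrite linearZ /= trmx_gen scalerN.
Qed.

Lemma Spin_trmx z : Spin z -> invmx z = z^T.
Proof.
move=> zS; have [zu _] := Spin_conj 0 zS.
apply: (can_inj (mulKmx zu)); rewrite mulmxV //.
have [s [_ s1 ->]] := zS; elim: s s1 => [|v s IH] s1.
  by rewrite big_nil mul1mx trmx1.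
rewrite big_cons; set y := \prod_(w <- s) clv w in IH *.
rewrite -[clv v * y]/(clv v *m y) trmx_mul mulmxA -(mulmxA _ y) -IH ?mulmx1.
  by rewrite trmx_clv mulmxN clv_sqr ?opprK // s1 ?mem_head.
by move=> w ws; apply: s1; rewrite in_cons ws orbT.
Qed.

Lemma clv_inj : injective (@clv R n).
Proof.
by move=> u v uv; apply/colP => k; rewrite -!clv_coord uv.
Qed.

Lemma PiP z (Q : 'M[R]_n.+1) : Spin z ->
  (forall k, z *m gen k = clv (col k Q) *m z) -> Pi z = Q.
Proof.
move=> zS zQ; apply/matrixP => x k.
have [zu] := Spin_conj (delta_mx k 0) zS.
rewrite clv_delta zQ mulmxK // => /clv_inj/colP/(_ x).
by rewrite -colE !mxE.
Qed.

Lemma Spin_mulmx_gen z k : Spin z -> z *m gen k = clv (col k (Pi z)) *m z.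
Proof.
move=> zS; have [zu] := Spin_conj (delta_mx k 0) zS.
by rewrite clv_delta -colE => <-; rewrite mulmxKV.
Qed.

Lemma Spin_mulmx_clv z v : Spin z -> z *m clv v = clv (Pi z *m v) *m z.
Proof. by move=> zS; have [zu <-] := Spin_conj v zS; rewrite mulmxKV. Qed.

Lemma Pi_mul z y : Spin z -> Spin y -> Pi (z *m y) = Pi z *m Pi y.
Proof.
move=> zS yS; apply: PiP; first exact: Spin_mul.
move=> k; rewrite -mulmxA Spin_mulmx_gen // mulmxA Spin_mulmx_clv //.
by rewrite !colE !mulmxA.
Qed.

Lemma Pi1 : Pi (1%:M : Cl) = 1%:M.
Proof.
apply: PiP; first exact: Spin1.
by move=> k; rewrite mul1mx mulmx1 col1 clv_delta.
Qed.

Lemma Pi_alpha j t : Pi (alpha j t : Cl) = rot j t.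
Proof.
apply: PiP; first exact: Spin_alpha.
move=> k; set a := idx j; set b := idxS j.
have ab : a != b by rewrite /a /b idx_neq.
have ba : (b == a) = false by rewrite eq_sym (negbTE ab).
have Ja : plane j *m gen a = gen b.
  rewrite /plane -mulmxA [gen _ *m gen a]gen_anticomm ?[idxS j == _]eq_sym //.
  by rewrite mulmxN mulmxA gen_sqr mul_scalar_mx scaleN1r opprK.
have Jb : plane j *m gen b = - gen a.
  by rewrite /plane -mulmxA gen_sqr mul_mx_scalar scaleN1r.
have aJ : gen a *m plane j = - gen b.
  by rewrite /plane mulmxA gen_sqr mul_scalar_mx scaleN1r.
have bJ : gen b *m plane j = gen a.
  rewrite /plane mulmxA [gen b *m _]gen_anticomm ?ba //.
  by rewrite mulNmx -mulmxA gen_sqr mul_mx_scalar scaleN1r opprK.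
have tE : t = t / 2 + t / 2 by rewrite -splitr.
have ct : cos t * cos (t / 2) + sin t * sin (t / 2) = cos (t / 2).
  by rewrite -cosB {1}tE addrK.
have st : sin t * cos (t / 2) - cos t * sin (t / 2) = sin (t / 2).
  by rewrite -sinB {1}tE addrK.
have clv2 (x y : R) :
    clv (x *: delta_mx a 0 + y *: delta_mx b 0 : 'cV[R]_n.+1) =
    x *: gen a + y *: gen b :> Cl.
  by rewrite linearD /= !linearZ /= !clv_delta.
have mul_plane (x y p q : R) :
    (x *: gen a + y *: gen b) *m (p *: 1%:M + q *: plane j) =
    (x * p + y * q) *: gen a + (y * p - x * q) *: gen b.
  rewrite mulmxDl !mulmxDr -!scalemxAl -!scalemxAr !mulmx1 aJ bJ.
  by move: (gen a) (gen b) => A B; apply/matrixP => u v; rewrite !mxE; ring.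
rewrite alphaE; have [->|ka] := eqVneq k a.
  have -> : col a (rot j t) = cos t *: delta_mx a 0 + sin t *: delta_mx b 0.
    by apply/colP => x; rewrite [LHS]mxE rotE eqxx !mxE !andbT; ring.
  rewrite clv2 mul_plane ct st.
  by rewrite mulmxDl -!scalemxAl mul1mx Ja.
have [->|kb] := eqVneq k b.
  have -> : col b (rot j t) = - sin t *: delta_mx a 0 + cos t *: delta_mx b 0.
    by apply/colP => x; rewrite [LHS]mxE rotE ba eqxx !mxE !andbT; ring.
  rewrite clv2 mul_plane.
  have -> : - sin t * cos (t / 2) + cos t * sin (t / 2) = - sin (t / 2).
    by rewrite -[in RHS]st; ring.
  have -> : cos t * cos (t / 2) - - sin t * sin (t / 2) = cos (t / 2).
    by rewrite -[RHS]ct; ring.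
  rewrite mulmxDl -!scalemxAl mul1mx Jb.
  by rewrite addrC scalerN scaleNr.
have -> : col k (rot j t) = delta_mx k 0.
  apply/colP => x; rewrite [LHS]mxE rotE (negbTE ka) (negbTE kb) mxE andbT.
  by [].
rewrite clv_delta mulmxDl mulmxDr -!scalemxAl -!scalemxAr mul1mx mulmx1.
rewrite /plane -mulmxA [gen _ *m gen k]gen_anticomm 1?eq_sym // mulmxN mulmxA.
rewrite [gen _ *m gen k]gen_anticomm 1?eq_sym // mulNmx opprK mulmxA.
by [].
Qed.

End SpinElements.
Lemma class_C_alpha (R : realType) (V : normedModType R) n (j : 'I_n) k
    (U : set V) (f : V -> R^o) : open U -> class_C k U f ->
  class_C k U (fun x => alpha j (f x) : 'M[R]_#|{set 'I_n.+1}|).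
Proof.
move=> Uo fC.
have halfC := class_CM Uo (@class_C_cst _ _ R^o k U (2^-1) Uo) fC.
have [sC cC] := class_C_sin_cos Uo halfC.
apply: class_C_ext (class_CD Uo (class_CZl 1%:M Uo cC)
  (class_CZl (plane R j) Uo sC)) => // x _.
by rewrite alphaE [2^-1 * _]mulrC.
Qed.

(** * Reduced words *)

(** The length of [s] increases only if the transposition does not undo an
    inversion of [s]: otherwise every inversion of the product is one of [s],
    since the transposition preserves the order of all pairs of values but
    one. *)
Lemma inversions_coxeter n (s : 'S_n.+1) (j : 'I_n) :
  inversions (s * coxeter j)%g = (inversions s).+1 ->
  ((s^-1)%g (idx j) < (s^-1)%g (idxS j))%N.
Proof.
move=> inv_s; rewrite ltnNge; apply/negP => ba.
suff : (inversions (s * coxeter j)%g <= inversions s)%N by rewrite inv_s ltnn.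
apply/subset_leq_card/fintype.subsetP => -[p p']; rewrite !inE /= => /andP[pp'].
rewrite pp' !permM /coxeter /=.
have swap (x y : 'I_n.+1) :
    (tperm (idx j) (idxS j) y < tperm (idx j) (idxS j) x)%N ->
    ~~ (y < x)%N -> x != y -> x = idx j /\ y = idxS j.
  move=> txy yx xy.
  have {yx xy} xy : (x < y)%N by rewrite ltn_neqAle xy leqNgt.
  have bE : (idxS j = j.+1 :> nat) by [].
  have aE : (idx j = j :> nat) by [].
  have E (u v : 'I_n.+1) : u <> v -> (u <> v :> nat) by move=> uv /val_inj.
  case: tpermP txy => [yE|yE|/E ya /E yb]; case: tpermP => [xE|xE|/E xa /E xb];
    rewrite ?bE ?aE => txy; split=> //; subst; lia.
move=> tpp'; apply/negPn/negP => spp'.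
have sp : s p != s p' by rewrite (inj_eq perm_inj) neq_ltn pp'.
have [pE p'E] := swap _ _ tpp' spp' sp.
by rewrite -pE -p'E !permK leqNgt pp' in ba.
Qed.

Lemma signed_perm_rot (R : realType) n (j : 'I_n) (e : R) : e = 1 \/ e = -1 ->
  signed_perm (coxeter j) (rot j (e * (pi / 2))).
Proof.
move=> e1; have e2 : e * e = 1 by case: e1 => ->; rewrite ?mulrNN mulr1.
exists (fun k => if k == idx j then e == 1 else (k == idxS j) && (e != 1)).
have N11 : (-1 == 1 :> R) = false.
  by apply/negbTE; rewrite -subr_eq0 -opprD oppr_eq0 -mulr2n pnatr_eq0.
have ba : (idxS j == idx j) = false by rewrite eq_sym idx_neq.
apply/matrixP => k l; rewrite rotE [RHS]mxE (cos_sign e2) (sin_sign e2).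
rewrite cos_pihalf sin_pihalf !mulr1 !mulr0 add0r sub0r /coxeter.
case: tpermP => [->|->|/eqP/negbTE ka /eqP/negbTE kb].
- rewrite eqxx idx_neq mul0r mul1r; case: (eqVneq l (idx j)) => [->|la].
    by rewrite idx_neq.
  case: (eqVneq l (idxS j)) => [_|//].
  by case: e1 => ->; rewrite ?eqxx ?N11 ?opprK.
- rewrite !eqxx ba mul0r mul1r oppr0; case: (eqVneq l (idx j)) => [_|la].
    by case: e1 => ->; rewrite ?eqxx ?N11.
  by case: (eqVneq l (idxS j)).
- rewrite ka kb !mul0r oppr0 [l == k]eq_sym; case: (eqVneq l (idx j)) => [->|la].
    by rewrite ka.
  case: (eqVneq l (idxS j)) => [->|lb]; first by rewrite kb.
  by case: eqP.
Qed.

Lemma Quat_signed_perm (R : realType) n (q : 'M[R]_#|{set 'I_n.+1}|) :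
  Quat q -> Spin q /\ signed_perm 1%g (Pi q).
Proof.
move=> [qS [[_ [s [d qE]]] /is_diag_mxP qD]]; split=> //.
exists d; rewrite qE; apply/matrixP => k l; rewrite !mxE perm1.
suff -> : s k = k by [].
apply/eqP/negPn/negP => sk; have := qD k (s k).
rewrite qE mxE eqxx eq_sym => /(_ sk)/eqP.
by rewrite signr_eq0.
Qed.

Lemma word_spin_signed_perm (R : realType) n k (i : 'I_k -> 'I_n)
    (e : 'I_k -> int) : (forall l, e l = 1 \/ e l = -1) ->
  Spin (word_spin R i e) /\ signed_perm (word_perm i) (Pi (word_spin R i e)).
Proof.
move=> e1; rewrite /word_spin /word_perm.
apply: (big_ind2 (fun z s => Spin z /\ signed_perm s (Pi z))) =>
  [|z s y t [zS zP] [yS yP]|l _].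
- split; first exact: Spin1.
  rewrite (_ : Pi _ = 1%:M); last exact: Pi1.
  by exists xpred0; apply/matrixP => x y; rewrite !mxE perm1 eq_sym; case: eqP.
- split; first exact: Spin_mul.
  by rewrite -[z * y]/(z *m y) Pi_mul //; exact: signed_perm_mul.
rewrite zpow_acute //; split; first exact: Spin_alpha.
rewrite Pi_alpha; apply: signed_perm_rot.
by case: (e1 l) => ->; [left|right].
Qed.

(** * The two maps between the cells *)

Lemma sin_complement (R : realType) (t : R) : sin (pi / 2 - t) = cos t.
Proof. by rewrite -opprB sinN sinBpihalf opprK. Qed.

Lemma cos_complement (R : realType) (t : R) : cos (pi / 2 - t) = sin t.
Proof. by rewrite -opprB cosN cosBpihalf. Qed.

Lemma connected_image (R : realType) (V W : normedModType R) (A U : set V)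
    (f : V -> W) :
  A `<=` U -> class_C 0 U f -> connected A -> connected (f @` A).
Proof.
move=> AU fC cA; apply: connected_continuous_connected cA _.
by apply: continuous_in_subspaceT => x; rewrite inE => /AU; exact: fC.
Qed.

Section Diffeomorphism.
Variables (R : realType) (n : nat) (j : 'I_n) (s1 : 'S_n.+1) (e : R).
Local Notation Cl := 'M[R]_#|{set 'I_n.+1}|.
Local Notation a := (idx j).
Local Notation b := (idxS j).
Variable w1 : Cl.
Hypotheses (e1 : e = 1 \/ e = -1) (w1S : Spin w1)
  (w1P : signed_perm s1 (Pi w1)) (s1ab : ((s1^-1)%g a < (s1^-1)%g b)%N).

Let e2 : e * e = 1. Proof. by case: e1 => ->; rewrite ?mulrNN mulr1. Qed.
Let s0 := (s1 * coxeter j)%g.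
Let w0 : Cl := w1 *m alpha j (e * (pi / 2)).
Let cell w := (@Spin R n) `&` (@Pi R n) @^-1` (bruhat_cell (Pi w) `&` (@SO R n)).

Lemma Pi_w0 : Pi w0 = Pi w1 *m rot j (e * (pi / 2)).
Proof. by rewrite /w0 Pi_mul ?Pi_alpha //; exact: Spin_alpha. Qed.

Lemma w0P : signed_perm s0 (Pi w0).
Proof. by rewrite Pi_w0; apply: signed_perm_mul => //; exact: signed_perm_rot. Qed.

Lemma s0ba : ((s0^-1)%g b < (s0^-1)%g a)%N.
Proof. by rewrite /s0 invMg !permM tpermV tpermL tpermR. Qed.

(** The number [t] in the interval from [0] to [pi] with
    [cot t = e * cell_ratio j s0 Q]. *)
Definition angle (Q : 'M[R]_n.+1) : R := pi / 2 - atan (e * cell_ratio j s0 Q).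

Lemma angle_pi Q : 0 < angle Q < pi.
Proof.
have := atan_gtNpi2 (e * cell_ratio j s0 Q).
have := atan_ltpi2 (e * cell_ratio j s0 Q).
by rewrite /angle; move: (atan _) => u; have := @pi_gt0 R; lra.
Qed.

(** The number that [cell_ratio] reads off from [Pi z *m rot j (e * t)] is
    [e * cot t], by [bruhat_cell_rot]; this is why [angle] recovers [t]. *)
Lemma cell_alpha z t : cell w1 z -> 0 < t < pi ->
  cell w0 (z *m alpha j (e * t)) /\ angle (Pi (z *m alpha j (e * t))) = t.
Proof.
move=> [zS [zP zSO]] /andP[t0 tpi].
have aS u : Spin (alpha j u : Cl) by exact: Spin_alpha.
have PiE : Pi (z *m alpha j (e * t)) = Pi z *m rot j (e * t).
  by rewrite Pi_mul // Pi_alpha.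
have [U1 [U2 [U1p U2p QE U2ab]]] := bruhat_cell_rot e2 t0 tpi w1P s1ab zP.
rewrite -Pi_w0 in QE; split.
  split; first exact: Spin_mul.
  split; rewrite PiE; last by apply: SO_mul => //; exact: rot_SO.
  by exists U1, U2.
have := cell_ratioE w0P U1p U2p s0ba; rewrite -QE PiE.
rewrite /angle; set r := cell_ratio _ _ _ => rE.
have st0 := sin_step_gt0 t0 tpi.
have U2a : U2 a a != 0 by rewrite gt_eqF //; case: U2p.
have rs : e * r * sin t = cos t.
  apply: (mulIf U2a).
  have -> : e * r * sin t * U2 a a = e * (r * U2 a a * sin t) by ring.
  by rewrite rE U2ab !mulrA e2 mul1r.
have -> : e * r = tan (pi / 2 - t).
  by rewrite /tan sin_complement cos_complement -rs mulfK // gt_eqF.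
rewrite tanK; first by ring.
by rewrite in_itv /=; lra.
Qed.

Lemma cell_alphaV z : cell w0 z -> cell w1 (z *m alpha j (- (e * angle (Pi z)))).
Proof.
move=> [zS [zP zSO]].
have aS u : Spin (alpha j u : Cl) by exact: Spin_alpha.
have /andP[t0 tpi] := angle_pi (Pi z).
have [U1 [U2 [U1p U2p QE]]] := zP.
split; first exact: Spin_mul.
rewrite /preimage /= Pi_mul // Pi_alpha; split; last first.
  by apply: SO_mul => //; exact: rot_SO.
have := cell_ratioE w0P U1p U2p s0ba; rewrite -QE => rE.
rewrite [X in X *m _]QE Pi_w0; apply: bruhat_cell_rotV => //.
rewrite /angle; set r := cell_ratio _ _ _ in rE *.
have -> : cos (pi / 2 - atan (e * r)) = e * r * sin (pi / 2 - atan (e * r)).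
  rewrite sin_complement cos_complement -{2}(atanK (e * r)) /tan divfK //.
  by rewrite gt_eqF // cos_gt0_pihalf // atan_gtNpi2 atan_ltpi2.
by rewrite -rE; ring.
Qed.

(** On [Spin] the inverse is the transpose, so that this polynomial map agrees
    with [Pi] there, while it is smooth on the whole algebra. *)
Definition Pi_poly (z : Cl) : 'M[R]_n.+1 :=
  \matrix_(k, l) (z *m gen R l *m z^T)
    (enum_rank [set k]%SET) (enum_rank finset.set0).

Lemma Pi_polyE z : Spin z -> Pi_poly z = Pi z.
Proof.
by move=> zS; apply/matrixP => k l; rewrite [LHS]mxE -Spin_trmx // [RHS]mxE.
Qed.

Let fl (z : Cl) := flag_mx j s0 (Pi_poly z).
Let dom : set Cl := [set z | fl z \in unitmx].
Definition theta (z : Cl) : R := angle (Pi_poly z).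
Definition drop_alpha (z : Cl) : Cl := z *m alpha j (- (e * theta z)).

Lemma class_C_Pi_poly k (U : set Cl) : open U -> class_C k U Pi_poly.
Proof.
move=> Uo; have idC := @class_C_id R Cl k U Uo.
have trC : class_C k U (fun z : Cl => z^T).
  apply: class_C_mx => // x y.
  apply: class_C_ext (class_C_coord y x Uo idC) => // z _.
  by rewrite mxE.
apply: class_C_mx => // x y.
pose M (z : Cl) : Cl := z *m gen R y *m z^T.
have MC : class_C k U M.
  apply: class_C_mulmx => //; apply: class_C_mulmx => //.
  exact: class_C_cst.
apply: class_C_ext (class_C_coord (enum_rank [set x]%SET)
  (enum_rank finset.set0) Uo MC) => // z _.
by rewrite [RHS]mxE.
Qed.

Lemma class_C_flag k (U : set Cl) : open U -> class_C k U fl.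
Proof.
move=> Uo; apply: class_C_mx => // x y; case: (leqP y a) => ya.
  apply: class_C_ext (class_C_coord x y Uo (class_C_Pi_poly k Uo)) => // z _.
  by rewrite [RHS]mxE ya.
apply: class_C_ext (@class_C_cst _ _ R^o k U ((s0 x == y)%:R) Uo) => // z _.
by rewrite [RHS]mxE leqNgt ya.
Qed.

Lemma open_dom : open dom.
Proof.
have -> : dom = (fun z => \det (fl z) : R^o) @^-1` [set x | x != 0].
  by apply/seteqP; split => z; rewrite /dom /= unitmxE unitfE.
apply: open_comp; last exact: open_neq.
by move=> z _; apply: (@class_C_det _ _ _ 0 setT) => //; [exact: openT|
  exact: class_C_flag openT].
Qed.

Lemma cell_dom z : cell w0 z -> dom z.
Proof.
move=> [zS [[U1 [U2 [U1p U2p QE]]] _]].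
by rewrite /dom /= /fl Pi_polyE // QE; apply: flag_mx_unit => //; exact: w0P.
Qed.

Lemma class_C_theta k : class_C k dom (theta : Cl -> R^o).
Proof.
have Uo := open_dom.
have rC : class_C k dom (fun z => (invmx (fl z) *m Pi_poly z) a b : R^o).
  apply: class_C_coord => //; apply: class_C_mulmx => //.
    by apply: class_C_invmx => //; exact: class_C_flag.
  exact: class_C_Pi_poly.
have aC := class_C_atan Uo (class_CM Uo (@class_C_cst _ _ R^o k dom e Uo) rC).
apply: class_C_ext (class_CD Uo (@class_C_cst _ _ R^o k dom (pi / 2) Uo)
  (class_CM Uo (@class_C_cst _ _ R^o k dom (-1) Uo) aC)) => // z _.
by rewrite mulN1r.
Qed.

Lemma class_C_drop_alpha k : class_C k dom drop_alpha.
Proof.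
have Uo := open_dom; apply: class_C_mulmx => //.
  exact: class_C_id.
apply: class_C_alpha => //.
apply: class_C_ext (class_CM Uo (@class_C_cst _ _ R^o k dom (- e) Uo)
  (class_C_theta k)) => // z _.
by rewrite mulNr.
Qed.

Lemma theta_alpha z t : cell w1 z -> 0 < t < pi -> theta (z *m alpha j (e * t)) = t.
Proof.
move=> zC tI; rewrite /theta Pi_polyE; first by case: (cell_alpha zC tI).
by case: zC => zS _; apply: Spin_mul => //; exact: Spin_alpha.
Qed.

Lemma drop_alphaK z t : cell w1 z -> 0 < t < pi ->
  drop_alpha (z *m alpha j (e * t)) = z.
Proof.
move=> zC tI; rewrite /drop_alpha theta_alpha // -mulmxA alphaD subrr alpha0.
exact: mulmx1.
Qed.

Lemma alpha_dropK z : drop_alpha z *m alpha j (e * theta z) = z.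
Proof. by rewrite /drop_alpha -mulmxA alphaD addNr alpha0 mulmx1. Qed.

Lemma pihalf_itv : 0 < (pi / 2 : R) < pi.
Proof. by have := @pi_gt0 R; lra. Qed.

(** The rotation by [pi / 2] moves a connected subset through [w1] and [z] to one
    through [w0]; the angle is then varied from [pi / 2] to [t]. *)
Lemma Bru_alpha z t : Bru w1 z -> 0 < t < pi -> Bru w0 (z *m alpha j (e * t)).
Proof.
move=> [C [Cw1 CX cC] Cz] tI.
have To (V : normedModType R) : open (@setT V) := openT.
have step1 : Bru w0 (z *m alpha j (e * (pi / 2))).
  pose f (y : Cl) : Cl := y *m alpha j (e * (pi / 2)).
  have fC : class_C 0 setT f.
    apply: class_C_mulmx => //; last exact: class_C_cst.
    exact: class_C_id.
  exists (f @` C); last by exists z.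
  split; [by exists w1| |exact: connected_image (@subsetT _ C) fC cC].
  by move=> _ [y Cy <-]; case: (cell_alpha (CX y Cy) pihalf_itv).
apply: connected_component_trans step1 _.
pose h (u : R^o) : Cl := z *m alpha j (e * u).
have hC : class_C 0 setT h.
  apply: class_C_mulmx => //; first exact: class_C_cst.
  apply: class_C_alpha => //; apply: class_CM => //; first exact: class_C_cst.
  exact: class_C_id.
pose J : set R^o := [set u : R | 0 < u < pi].
have cJ : connected J.
  apply/connected_intervalP => x y /andP[x0 _] /andP[_ yp] u /andP[xu uy].
  by rewrite /J /= (lt_le_trans x0 xu) (le_lt_trans uy yp).
exists (h @` J); last by exists t.
split; last exact: connected_image (@subsetT _ J) hC cJ.
  by exists (pi / 2) => //; exact: pihalf_itv.
by move=> _ [u Ju <-]; case: (cell_alpha (CX z Cz) Ju).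
Qed.

Lemma Bru_drop_alpha z : Bru w0 z -> Bru w1 (drop_alpha z).
Proof.
move=> [C [Cw0 CX cC] Cz].
have w1C : cell w1 w1.
  split=> //; split.
    by exists 1%:M, 1%:M; rewrite mul1mx mulmx1; split=> //; exact: Upplus1.
  have -> : Pi w1 = Pi w0 *m rot j (- (e * (pi / 2))).
    by rewrite Pi_w0 -mulmxA rotD subrr rot0 mulmx1.
  by apply: SO_mul; [case: (CX _ Cw0) => _ []|exact: rot_SO].
exists (drop_alpha @` C); last by exists z.
split.
- by exists w0 => //; apply: drop_alphaK => //; exact: pihalf_itv.
- move=> _ [y /CX yC <-]; rewrite /drop_alpha /theta Pi_polyE; last by case: yC.
  exact: cell_alphaV.
- have Cdom : C `<=` dom by move=> y /CX; exact: cell_dom.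
  exact: connected_image Cdom (class_C_drop_alpha 0) cC.
Qed.

Lemma Bru_sub w : Bru w `<=` cell w.
Proof. exact: connected_component_sub. Qed.

Lemma diffeomorphism_alpha :
  diffeomorphism (Bru w1 `*` `]0, pi[ : set (Cl * R^o)) (Bru w0)
    (fun p => p.1 *m alpha j (e * p.2)).
Proof.
exists (fun z => (drop_alpha z, theta z)); split.
- move=> [z t] [/= zB]; rewrite in_itv /= => tI; exact: Bru_alpha.
- move=> z zB; split => /=; first exact: Bru_drop_alpha.
  by rewrite in_itv /=; exact: angle_pi.
- move=> [z t]; rewrite inE /= => -[/= /Bru_sub zC]; rewrite in_itv /= => tI.
  by rewrite drop_alphaK // theta_alpha.
- by move=> z _ /=; exact: alpha_dropK.
split=> [p _|z /Bru_sub zC].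
- exists setT, (fun p : Cl * R^o => p.1 *m alpha j (e * p.2)).
  have To : open (@setT (Cl * R^o)%type) := openT.
  split=> // k; apply: class_C_mulmx => //.
    exact: class_C_fst.
  apply: class_C_alpha => //; apply: class_CM => //; first exact: class_C_cst.
  exact: class_C_snd.
- exists dom, (fun z => (drop_alpha z, theta z) : Cl * R^o).
  split=> //; [exact: open_dom|exact: cell_dom|] => k.
  apply: class_C_pair; [exact: open_dom|exact: class_C_drop_alpha|].
  exact: class_C_theta.
Qed.

End Diffeomorphism.


Theorem theorem1 (R : realType) (n : nat) (hn : (2 <= n)%N)
    (k : nat) (i : 'I_k -> 'I_n) (j : 'I_n)
    (red1 : inversions (word_perm i) = k)
    (red0 : inversions (word_perm i * coxeter j)%g = k.+1)
    (e : 'I_k -> int) (he : forall l, e l = 1 \/ e l = -1)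
    (eps : int) (heps : eps = 1 \/ eps = -1)
    (q : 'M[R]_#|{set 'I_n.+1}|) (hq : Quat q) :
  let z1 := word_spin R i e in
  let z0 := z1 *m zpowmx (acute R j) eps in
  diffeomorphism
    (Bru (q *m z1) `*` `]0, pi[ : set ('M[R]_#|{set 'I_n.+1}| * R^o))
    (Bru (q *m z0))
    (fun p => p.1 *m alpha j (eps%:~R * p.2)).
Proof.
move=> z1 z0; rewrite /z0 zpow_acute // mulmxA.
have [qS qP] := Quat_signed_perm hq.
have [zS zP] := word_spin_signed_perm R i he.
apply: (@diffeomorphism_alpha _ _ _ (word_perm i)).
- by case: heps => ->; [left|right].
- exact: Spin_mul.
- by rewrite Pi_mul // -[word_perm i]mul1g; exact: signed_perm_mul.
- by apply: inversions_coxeter; rewrite red0 red1.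
Qed.
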